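(* Every $G\in\mathcal G$ is the kernel of some $f\in\mathcal F$. Moreover $f$ is essentially unique: any $g\in\mathcal F$ with $\ker g=G$ is of the form $g=\epsilon\tau^n\circ f$ for some $\epsilon\in C^\ast$ and $n\in\mathbb Z$.
   Context: Let $p$ be a prime, $q$ a power of $p$, and $C$ an algebraically closed field containing $\mathbb F_q$, complete with respect to a non-archimedean absolute value $|\cdot|$; let $v(z)=-\log|z|$ ($v(0)=+\infty$) and $\Delta_r=\{x\in C:|x|\le r\}$. $\mathcal F$ is the set of formal sums $f=\sum_{n\in\mathbb Z}a_n\tau^n$ ($a_n\in C$) such that $f(z)=\sum_n a_nz^{q^n}$ converges for all $z\in C$ (here $z^{q^n}$ for $n<0$ is the unique $q^{-n}$-th root); it is a ring under addition and composition $(\sum a_i\tau^i)\circ(\sum b_j\tau^j)=\sum_n(\sum_{i+j=n}a_ib_j^{q^i})\tau^n$ (composition of maps), with $c\in C$ identified with multiplication by $c$ and $\tau$ the map $z\mapsto z^q$. $\ker f=\{z\in C:f(z)=0\}$. Fix a real $r>0$. $\mathcal G$ is the collection of sub-$\mathbb F_q$-vector spaces $G\subseteq C$ such that: (1) $G\cap\Delta_r$ is compact; (2) $\int_{G\cap\Delta_r}v=+\infty$ with respect to a Haar measure on $G\cap\Delta_r$; (3) $G\cap\Delta_r$ has finite or countable index in $G$, and in the countable case any system of coset representatives $g_1,g_2,\dots$ satisfies $|g_n|\to+\infty$. *)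

(* Defs.v *)
From HB Require Import structures.
From mathcomp Require Import all_boot all_order all_algebra.
From mathcomp Require Import all_classical all_reals all_analysis.

Set Implicit Arguments.
Unset Strict Implicit.
Unset Printing Implicit Defensive.
Import Order.TTheory GRing.Theory Num.Theory.
Local Open Scope classical_set_scope.
Local Open Scope ring_scope.

(* MathComp's normed structures require `|x *+ n| = `|x| *+ n, which is
   impossible in positive characteristic; hence a dedicated record. *)
Record nonarch_abs (R : realType) (C : fieldType) := NonArchAbs {
  nabs :> C -> R ;
  nabs_ge0 : forall x, 0 <= nabs x ;
  nabs_eq0 : forall x, nabs x = 0 <-> x = 0 ;
  nabsM : forall x y, nabs (x * y) = nabs x * nabs y ;
  nabsD_max : forall x y, nabs (x + y) <= Num.max (nabs x) (nabs y)
}.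

(* [valued a] is the field C with the metric topology of the absolute value a. *)
Definition valued (R : realType) (C : closedFieldType) (a : nonarch_abs R C) :
  Type := C.

Section Valued.
Variables (R : realType) (C : closedFieldType) (a : nonarch_abs R C).

Local Notation K := (valued a).

HB.instance Definition _ := GRing.ClosedField.on K.
HB.instance Definition _ := isPointed.Build K 0.

Let dist_ball : K -> R -> set K := ball_ (a : K -> R).

Let nabs1 : a 1 = 1.
Proof.
have a1_neq0 : a 1 != 0 by apply/eqP => /nabs_eq0/eqP; rewrite oner_eq0.
by apply: (mulfI a1_neq0); rewrite -nabsM !mulr1.
Qed.

Let nabsN x : a (- x) = a x.
Proof.
suff aN1 : a (- 1) = 1 by rewrite -mulN1r nabsM aN1 mul1r.
apply/eqP; rewrite -(@eqrXn2 _ 2%N) ?nabs_ge0 ?ler01//.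
by rewrite expr1n expr2 -nabsM mulrNN mulr1 nabs1.
Qed.

Let dist_ball_center (x : K) (e : R) : 0 < e -> dist_ball x e x.
Proof. by rewrite /dist_ball /= subrr (nabs_eq0 a 0).2. Qed.

Let dist_ball_sym (x y : K) (e : R) : dist_ball x e y -> dist_ball y e x.
Proof. by rewrite /dist_ball /= -opprB nabsN. Qed.

Let dist_ball_triangle (x y z : K) (e1 e2 : R) :
  dist_ball x e1 y -> dist_ball y e2 z -> dist_ball x (e1 + e2) z.
Proof.
rewrite /dist_ball /= => xy yz; rewrite -(subrKA y).
apply: le_lt_trans (nabsD_max _ _ _) _.
rewrite gt_max (lt_le_trans xy) ?(lt_le_trans yz)//.
- by rewrite lerDr (le_trans _ (ltW xy))// nabs_ge0.
- by rewrite lerDl (le_trans _ (ltW yz))// nabs_ge0.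
Qed.

HB.instance Definition _ := hasNbhs.Build K (nbhs_ball_ dist_ball).

Let dist_nbhsE : @nbhs K K = nbhs_ (entourage_ dist_ball).
Proof.
rewrite predeq2E => x P; split => [[e e0 xeP]|[A [e e0 eA] AP]].
  exists [set xy | dist_ball xy.1 e xy.2]; first by exists e.
  by move=> y /xsectionP/xeP.
by exists e => // y xy; exact/AP/xsectionP/eA.
Qed.

HB.instance Definition _ := @Nbhs_isPseudoMetric.Build R K
  (entourage_ dist_ball) dist_nbhsE dist_ball
  dist_ball_center dist_ball_sym dist_ball_triangle erefl.

Definition abs_complete : Prop :=
  forall F : set_system K, ProperFilter F -> cauchy F -> cvg F.

End Valued.

Section Defs.
Variables (R : realType) (C0 : closedFieldType) (a : nonarch_abs R C0).
Local Notation C := (valued a).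
Implicit Types (q : nat) (n : int) (z : C) (r : R).

Definition valuation z : \bar R := if z == 0 then +oo%E else (- ln (a z))%:E.

Definition Delta r : set C := [set x | a x <= r].

(* z ^ (q ^ n); for n < 0 this is a q ^ (- n)-th root of z, which exists as C is
   algebraically closed and is unique when q is a power of the characteristic. *)
Definition qpow q n z : C :=
  match n with
  | Posz m => z ^+ (q ^ m)
  | Negz m => xget 0 [set y | y ^+ (q ^ m.+1) = z]
  end.

Definition cvg_zsum (u : int -> C) : Prop :=
  cvgn (series (fun k : nat => u (Posz k))) /\
  cvgn (series (fun k : nat => u (Negz k))).

Definition zsum (u : int -> C) : C :=
  limn (series (fun k : nat => u (Posz k))) +
  limn (series (fun k : nat => u (Negz k))).

(* A formal sum \sum_n f_n tau^n is represented by its coefficients. *)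
Definition tau_series := int -> C.

Definition tau_terms q (f : tau_series) z : int -> C :=
  fun n => f n * qpow q n z.

Definition tau_eval q (f : tau_series) z : C := zsum (tau_terms q f z).

Definition calF q : set tau_series :=
  [set f | forall z, cvg_zsum (tau_terms q f z)].

Definition tau_ker q (f : tau_series) : set C := [set z | tau_eval q f z = 0].

Definition tau_comp q (f g : tau_series) : tau_series :=
  fun n => zsum (fun i => f i * qpow q i (g (n - i))).

Definition tau_mono (c : C) n : tau_series := fun m => if m == n then c else 0.

Definition is_subspace (Fq : finFieldType) (iota : {rmorphism Fq -> C})
    (G : set C) : Prop :=
  [/\ G 0, forall x y, G x -> G y -> G (x + y)
    & forall (c : Fq) x, G x -> G (iota c * x)].

Definition borel := g_sigma_algebraType (@open C).

(* A Haar measure on a compact subgroup H of C, given as a measure on the Borel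
   sets of C of which only the values on Borel subsets of H matter. *)
Definition is_haar (H : set C) (mu : {measure set borel -> \bar R}) : Prop :=
  (0 < mu H < +oo)%E /\
  forall (x : C) (A : set C), H x -> A `<=` H -> measurable (A : set borel) ->
    mu [set x + y | y in A] = mu A.

Definition cosets (H G : set C) : set (set C) :=
  [set [set x + h | h in H] | x in G].

Definition coset_reps (H G : set C) (g : nat -> C) : Prop :=
  (forall k, G (g k)) /\
  (forall A, cosets H G A -> exists! k, A (g k)).

Definition calG (Fq : finFieldType) (iota : {rmorphism Fq -> C}) r :
    set (set C) :=
  [set G | let H := G `&` Delta r in
    [/\ is_subspace iota G,
        compact H,
        exists mu, is_haar H mu /\
          (\int[mu]_(x in (H : set borel)) valuation x = +oo)%E
      & countable (cosets H G) /\
        (infinite_set (cosets H G) -> forall g, coset_reps H G g ->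
           a (g k) @[k --> \oo] --> +oo)]].

End Defs.

(* Main.v *)
Require Import Defs.
From HB Require Import structures.
From mathcomp Require Import all_boot all_order all_algebra.
From mathcomp Require Import all_classical all_reals all_analysis.
From mathcomp Require Import measurable_realfun finmap finfield zify ring.
Import Order.TTheory GRing.Theory Num.Theory.
Local Open Scope classical_set_scope.
Local Open Scope ring_scope.
Set Implicit Arguments.
Unset Strict Implicit.
Unset Printing Implicit Defensive.

(** Write [gauss_le f z B] when all terms of the series [f z] have absolute value
at most [B]. The main tool is surjectivity with control: for [f] in F nonzero and
any [y] there is [w] with [f w = y] and [gauss_le f w |y|] (take a root of minimal
absolute value of a truncation of [f], which is an additive polynomial up to a
power of tau, then iterate on the remainder). In particular the sup norm on a disc
is the Gauss norm.

Existence. Put [H = G `&` Delta r] and let [x_0, x_1, ...] be dense in [H]. Starting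
from the identity, the functions [f_m] are obtained by killing [x_0, ..., x_(m-1)]
one at a time, normalised so that the coefficient of tau^0 is 1. Then
[|f_m z| ^ (q ^ m)] is the product of [|z - y|] over the F_q-combinations [y] of the
killed points, so on [H] its logarithm is governed by the Haar average of the
valuation; as the integral is infinite, [f_m] tends to 0 uniformly on [H], which
makes [f_m] a Cauchy sequence whose limit has kernel [H]. From this limit the
remaining elements of [G] are killed in order of increasing absolute value, as in a
Weierstrass product.

Uniqueness. A series vanishing at [d <> 0] is divisible on the right by
[y - d (y / d) ^ q]; carrying this through the construction and the limits, any [g]
vanishing on [G] is [u o f] with [u] in F. If [ker g = G] then [ker u = 0], and a
series with trivial kernel is a monomial: otherwise at some radius two terms tie for
the maximum, and cancellation makes [u] smaller than its Gauss norm there. *)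

(** * Induction on the integers and extrema over finite lists *)

(** The downward step runs from [n + 1] to [n]: for identities between [qpow] values it reduces to
    injectivity of Frobenius, so roots need no separate treatment. *)
Lemma int_ind_succ (P : int -> Prop) : P 0 -> (forall n, P n -> P (n + 1)) ->
  (forall n, P (n + 1) -> P n) -> forall n, P n.
Proof.
move=> P0 Pup Pdown; elim/int_rect => [//|n Pn|n Pn].
  by rewrite -addn1 PoszD; exact: Pup.
by apply: Pdown; rewrite -addn1 PoszD opprD subrK.
Qed.

Lemma seq_argmax (R : realDomainType) (T : eqType) (F : T -> R) (s : seq T) :
  s != [::] -> exists2 x, x \in s & forall y, y \in s -> F y <= F x.
Proof.
elim: s => [//|x s IH] _; have [->|/IH[y ys ymax]] := eqVneq s [::].
  by exists x; rewrite ?mem_head// => y; rewrite inE => /eqP ->.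
have [yx|xy] := leP (F y) (F x).
  exists x; rewrite ?mem_head// => z; rewrite inE => /orP[/eqP ->//|zs].
  exact: le_trans (ymax _ zs) yx.
exists y; rewrite ?inE ?ys ?orbT// => z; rewrite inE => /orP[/eqP ->|/ymax//].
exact: ltW.
Qed.

Lemma seq_argmin (R : realDomainType) (T : eqType) (F : T -> R) (s : seq T) :
  s != [::] -> exists2 x, x \in s & forall y, y \in s -> F x <= F y.
Proof.
move=> /(seq_argmax (fun x => - F x))[x xs xmax].
by exists x => // y /xmax; rewrite lerN2.
Qed.

Lemma count_lt (T : eqType) (p p' : pred T) (s : seq T) y : (forall z, p z -> p' z) ->
  y \in s -> p' y -> ~~ p y -> (count p s < count p' s)%N.
Proof.
move=> pp' + p'y npy; elim: s => [//|z s IH]; rewrite inE => /orP[/eqP <-|/IH lt_s] /=.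
  by rewrite p'y (negPf npy) ltnS; exact: sub_count.
by apply: leq_ltn_trans (_ : p' z + count p s < _)%N; rewrite ?ltn_add2l// leq_add2r;
  case: (p z) (pp' z) => [->|].
Qed.

Lemma half_lt (R : realFieldType) (eps : R) : 0 < eps -> eps / 2 < eps.
Proof. by move=> eps0; rewrite ltr_pdivrMr// ltr_pMr// ltrDl ltr01. Qed.

(** * Ultrametric absolute values *)

Section Ultrametric.
Variables (R : realType) (C0 : closedFieldType) (a : nonarch_abs R C0).
Local Notation K := (valued a).
Implicit Types x y z w : K.

Lemma abs_ge0 x : 0 <= a x. Proof. exact: nabs_ge0. Qed.
Hint Resolve abs_ge0 : core.

Lemma absM x y : a (x * y) = a x * a y. Proof. exact: nabsM. Qed.

Lemma abs0 : a (0 : K) = 0. Proof. exact/nabs_eq0. Qed.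

Lemma abs_eq0 x : (a x == 0) = (x == 0).
Proof.
by apply/eqP/eqP => [/(nabs_eq0 a x).1|/(nabs_eq0 a x).2].
Qed.

Lemma abs_gt0 x : (0 < a x) = (x != 0).
Proof. by rewrite lt_def abs_eq0 abs_ge0 andbT. Qed.

Lemma abs1 : a (1 : K) = 1.
Proof.
have a1_neq0 : a (1 : K) != 0 by rewrite abs_eq0 oner_eq0.
by apply: (mulfI a1_neq0); rewrite -absM !mulr1.
Qed.

Lemma absX x n : a (x ^+ n) = a x ^+ n.
Proof. by elim: n => [|n IH]; rewrite ?expr0 ?abs1// !exprS absM IH. Qed.

Lemma absV x : a x^-1 = (a x)^-1.
Proof.
have [->|x0] := eqVneq x 0; first by rewrite invr0 abs0 invr0.
have ax0 : a x != 0 by rewrite abs_eq0.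
by apply: (mulfI ax0); rewrite -absM !divff// abs1.
Qed.

Lemma absf x y : a (x / y) = a x / a y. Proof. by rewrite absM absV. Qed.

Lemma absN x : a (- x) = a x.
Proof.
suff aN1 : a (- 1 : K) = 1 by rewrite -mulN1r absM aN1 mul1r.
apply/eqP; rewrite -(@eqrXn2 _ 2%N) ?abs_ge0 ?ler01//.
by rewrite expr1n -absX sqrrN expr1n abs1.
Qed.

Lemma absBC x y : a (x - y) = a (y - x). Proof. by rewrite -absN opprB. Qed.

Lemma absD_le x y B : a x <= B -> a y <= B -> a (x + y) <= B.
Proof. by move=> xB yB; rewrite (le_trans (nabsD_max a x y))// ge_max xB. Qed.

Lemma absB_le x y B : a x <= B -> a y <= B -> a (x - y) <= B.
Proof. by move=> xB yB; rewrite absD_le ?absN. Qed.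

Lemma absD_lt x y B : a x < B -> a y < B -> a (x + y) < B.
Proof. by move=> xB yB; rewrite (le_lt_trans (nabsD_max a x y))// gt_max xB. Qed.

Lemma absB_lt x y B : a x < B -> a y < B -> a (x - y) < B.
Proof. by move=> xB yB; rewrite absD_lt ?absN. Qed.

Lemma abs_sum_le (I : Type) (s : seq I) (P : pred I) (F : I -> K) B : 0 <= B ->
  (forall i, P i -> a (F i) <= B) -> a (\sum_(i <- s | P i) F i) <= B.
Proof.
move=> B0 FB; elim/big_rec: _ => [|i x Pi xB]; first by rewrite abs0.
by rewrite absD_le ?FB.
Qed.

Lemma abs_domD x y : a y < a x -> a (x + y) = a x.
Proof.
move=> yx; apply/eqP; rewrite eq_le absD_le ?(ltW yx)//=.
rewrite leNgt; apply/negP => xyx.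
have : a (x + y - y) < a x by rewrite absB_lt.
by rewrite addrK ltxx.
Qed.

Lemma abs_close x y : a (x - y) < a x -> a y = a x.
Proof. by rewrite absBC => h; rewrite -(abs_domD h) addrC subrK. Qed.

(** * Sequential limits *)

Definition tends (u : nat -> K) (l : K) : Prop :=
  forall eps : R, 0 < eps ->
  exists N, forall n, (N <= n)%N -> a (u n - l) < eps.

Lemma ballE x (e : R) y : ball x e y = (a (x - y) < e).
Proof. by []. Qed.

Lemma tendsP (u : nat -> K) l : tends u l <-> (u n @[n --> \oo] --> l).
Proof.
split=> [ul|ul].
  apply/cvg_ballP => eps eps0; have [N uN] := ul _ eps0.
  by exists N => // n /= Nn; rewrite ballE absBC; exact: uN.
move=> eps eps0; move/cvg_ballP: ul => /(_ _ eps0)[N _ uN].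
by exists N => n Nn; rewrite absBC; exact: uN.
Qed.

Lemma tends_unique (u : nat -> K) l l' : tends u l -> tends u l' -> l = l'.
Proof.
move=> ul ul'; apply/eqP; rewrite -subr_eq0 -abs_eq0 eq_le abs_ge0 andbT.
apply/ler_addgt0Pr => eps eps0; rewrite add0r.
have [[N uN] [N' uN']] := (ul _ eps0, ul' _ eps0).
have {uN} /ltW uN := uN (maxn N N') (leq_maxl _ _).
have {uN'} /ltW uN' := uN' (maxn N N') (leq_maxr _ _).
have -> : l - l' = (u (maxn N N') - l') - (u (maxn N N') - l) by ring.
exact: absB_le.
Qed.

Lemma tends_lim (u : nat -> K) l : tends u l -> limn u = l.
Proof.
move=> ul; apply: (@tends_unique u) => //; apply/tendsP.
by apply: (cvgP l); apply/tendsP.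
Qed.

Lemma tends_cst l : tends (fun=> l) l.
Proof. by move=> eps eps0; exists 0%N => n _; rewrite subrr abs0. Qed.

Lemma tends_eventually (u v : nat -> K) l N :
  (forall n, (N <= n)%N -> u n = v n) -> tends u l -> tends v l.
Proof.
move=> uv ul eps /ul[M uM]; exists (maxn N M) => n; rewrite geq_max => /andP[Nn Mn].
by rewrite -uv ?uM.
Qed.

Lemma tendsD (u v : nat -> K) l m :
  tends u l -> tends v m -> tends (fun n => u n + v n) (l + m).
Proof.
move=> ul vm eps eps0; have [[N uN] [M vM]] := (ul _ eps0, vm _ eps0).
exists (maxn N M) => n; rewrite geq_max => /andP[Nn Mn].
have -> : u n + v n - (l + m) = (u n - l) + (v n - m) by ring.
by rewrite absD_lt ?uN ?vM.
Qed.

Lemma tends_additive (phi : K -> K) (u : nat -> K) l :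
  (forall x y, phi (x - y) = phi x - phi y) ->
  (forall eps : R, 0 < eps ->
     exists2 d : R, 0 < d & forall x, a x < d -> a (phi x) < eps) ->
  tends u l -> tends (fun n => phi (u n)) (phi l).
Proof.
move=> phiB phi0 ul eps /phi0[d d0 phid]; have [N uN] := ul _ d0.
by exists N => n Nn; rewrite -phiB phid ?uN.
Qed.

Lemma tends_abs_le (u : nat -> K) l B N :
  (forall n, (N <= n)%N -> a (u n) <= B) -> tends u l -> a l <= B.
Proof.
move=> uB ul; apply/ler_addgt0Pr => eps eps0; have [M uM] := ul _ eps0.
have -> : l = u (maxn N M) - (u (maxn N M) - l) by ring.
have B0 : 0 <= B by exact: le_trans (uB _ (leqnn _)).
rewrite absB_le//.
  by rewrite (le_trans (uB _ _)) ?leq_maxl// lerDl ltW.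
by rewrite (le_trans (ltW (uM _ _))) ?leq_maxr// lerDr.
Qed.

(** A telescoping sum is bounded by its largest term, so consecutive differences control all later
    ones; hence the weak Cauchy criterion of [tends_cauchy]. *)
Lemma abs_step_le (u : nat -> K) B N :
  (forall n, (N <= n)%N -> a (u n.+1 - u n) <= B) ->
  forall m n, (N <= m)%N -> (m <= n)%N -> a (u n - u m) <= B.
Proof.
move=> uB m n Nm; have B0 : 0 <= B by exact: le_trans (uB _ Nm).
elim: n => [|n IH]; first by rewrite leqn0 => /eqP ->; rewrite subrr abs0.
rewrite leq_eqVlt => /orP[/eqP ->|]; first by rewrite subrr abs0.
rewrite ltnS => mn; rewrite -(subrKA (u n)) absD_le ?IH ?uB//.
exact: leq_trans mn.
Qed.

Section Complete.
Hypothesis complete_a : abs_complete a.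

Lemma tends_cauchy (u : nat -> K) :
  (forall eps : R, 0 < eps ->
     exists N, forall n, (N <= n)%N -> a (u n.+1 - u n) <= eps) ->
  exists l, tends u l.
Proof.
move=> uC; suff : cvgn u by move=> uc; exists (limn u); apply/tendsP.
apply: complete_a; apply: cauchy_exP => eps eps0.
have e2 : 0 < eps / 2 by rewrite divr_gt0.
have [N /abs_step_le uN] := uC _ e2.
exists (u N); exists N => // n /= Nn; rewrite ballE absBC.
by rewrite (le_lt_trans (uN _ _ _ Nn)) ?half_lt.
Qed.

End Complete.
End Ultrametric.

#[local] Hint Extern 0 (is_true (@Order.le _ _ _ (@nabs _ _ _ _))) =>
  exact: abs_ge0 : core.

(** * Powers z ^ (q ^ n) *)

Section TauSeries.
Variables (R : realType) (C0 : closedFieldType) (a : nonarch_abs R C0).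
Local Notation K := (valued a).
Variable q : nat.
Hypothesis complete_a : abs_complete a.
Hypotheses (q_gt1 : (1 < q)%N) (q_pchar : [pchar K].-nat q).
Implicit Types (x y z w : K) (n m : int).

Local Notation qp := (@qpow R C0 a q).

Let q_gt0 : (0 < q)%N. Proof. exact: ltnW. Qed.

Lemma exprqD x y k : (x + y) ^+ (q ^ k) = x ^+ (q ^ k) + y ^+ (q ^ k).
Proof. by apply: exprDn_pchar; rewrite pnatX q_pchar. Qed.

Lemma exprqN x k : (- x) ^+ (q ^ k) = - x ^+ (q ^ k).
Proof.
by apply/eqP; rewrite -subr_eq0 opprK -exprqD addNr expr0n expn_eq0 -leqn0 leqNgt q_gt0.
Qed.

Lemma exprq_inj k : injective (fun x : K => x ^+ (q ^ k)).
Proof.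
move=> x y /= /eqP; rewrite -subr_eq0 -exprqN -exprqD expf_eq0 subr_eq0.
by case/andP => _ /eqP.
Qed.

Lemma frobD x y : (x + y) ^+ q = x ^+ q + y ^+ q.
Proof. by rewrite -{1 2 3}(expn1 q) exprqD expn1. Qed.

Lemma frob_inj : injective (fun x : K => x ^+ q).
Proof. by move=> x y; rewrite -{1 2}(expn1 q) => /exprq_inj. Qed.

Lemma root_exists (k : nat) (b : K) : (0 < k)%N -> exists y : K, y ^+ k = b.
Proof.
move=> k0; have : size ('X^k - b%:P : {poly K}) != 1%N.
  by rewrite size_XnsubC// eqSS -lt0n.
by move=> /closed_rootP[y]; rewrite rootE !hornerE subr_eq0 => /eqP; exists y.
Qed.

Lemma qpow0 z : qp 0 z = z. Proof. exact: expr1. Qed.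

Lemma qpow_Negz k z : (qp (Negz k) z) ^+ (q ^ k.+1) = z.
Proof.
rewrite /qpow; set A := [set y | _]; suff : A (xget 0 A) by [].
by apply: xgetPex; apply: root_exists; rewrite expn_gt0 q_gt0.
Qed.

Lemma qpow_succ n z : qp (n + 1) z = qp n z ^+ q.
Proof.
case: n => k.
  by rewrite /qpow -PoszD addn1 expnS mulnC exprM.
(* On the root branch the roots chosen by [xget] are compared after raising both sides to the power
   [q ^ k], which is injective. *)
apply: (@exprq_inj k); rewrite -exprM -expnS qpow_Negz.
case: k => [|k]; first by rewrite NegzE addNr qpow0 expr1.
have -> : Negz k.+1 + 1 = Negz k by lia.
exact: qpow_Negz.
Qed.

Lemma qpow1 z : qp 1 z = z ^+ q. Proof. by rewrite -[1]add0r qpow_succ qpow0. Qed.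

Lemma qpowA n m z : qp n (qp m z) = qp (n + m) z.
Proof.
elim/int_ind_succ: n => [|n IH|n IH]; first by rewrite qpow0 add0r.
  by rewrite qpow_succ IH addrAC qpow_succ.
by apply: frob_inj; rewrite -!qpow_succ IH addrAC.
Qed.

Lemma qpowK n : cancel (qp n) (qp (- n)).
Proof. by move=> z; rewrite qpowA addNr qpow0. Qed.

Lemma qpowVK n : cancel (qp (- n)) (qp n).
Proof. by move=> z; rewrite qpowA addrN qpow0. Qed.

Lemma qpowM n x y : qp n (x * y) = qp n x * qp n y.
Proof.
elim/int_ind_succ: n => [|n IH|n IH]; first by rewrite !qpow0.
  by rewrite !qpow_succ IH exprMn.
by apply: frob_inj; rewrite exprMn -!qpow_succ IH.
Qed.

Lemma qpowD n x y : qp n (x + y) = qp n x + qp n y.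
Proof.
elim/int_ind_succ: n => [|n IH|n IH]; first by rewrite !qpow0.
  by rewrite !qpow_succ IH frobD.
by apply: frob_inj; rewrite frobD -!qpow_succ IH.
Qed.

Lemma qpow_0 n : qp n 0 = 0.
Proof. by apply: (addrI (qp n 0)); rewrite -qpowD !addr0. Qed.

Lemma qpowN n x : qp n (- x) = - qp n x.
Proof. by apply: (addrI (qp n x)); rewrite -qpowD !subrr qpow_0. Qed.

Lemma qpowB n x y : qp n (x - y) = qp n x - qp n y.
Proof. by rewrite qpowD qpowN. Qed.

Lemma qpow_eq0 n x : (qp n x == 0) = (x == 0).
Proof.
apply/eqP/eqP => [x0|->]; last exact: qpow_0.
by rewrite -(qpowK n x) x0 qpow_0.
Qed.

Lemma qpow_1 n : qp n 1 = 1.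
Proof.
have n1 : qp n 1 != 0 by rewrite qpow_eq0 oner_eq0.
by apply: (mulfI n1); rewrite -qpowM !mulr1.
Qed.

Lemma qpowV n x : qp n x^-1 = (qp n x)^-1.
Proof.
have [->|x0] := eqVneq x 0; first by rewrite invr0 qpow_0 invr0.
have nx0 : qp n x != 0 by rewrite qpow_eq0.
by apply: (mulfI nx0); rewrite -qpowM !divff// qpow_1.
Qed.

Lemma qpowX n x k : qp n (x ^+ k) = qp n x ^+ k.
Proof. by elim: k => [|k IH]; rewrite ?expr0 ?qpow_1// !exprS qpowM IH. Qed.

Lemma qpow_fixed n x : x ^+ q = x -> qp n x = x.
Proof.
move=> xq; elim/int_ind_succ: n => [|n IH|n IH]; first exact: qpow0.
  by rewrite qpow_succ IH.
by apply: frob_inj; rewrite -qpow_succ IH.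
Qed.

Lemma qpow_expr n z (k M : nat) : n + M%:Z = k%:Z -> qp n z ^+ (q ^ M) = z ^+ (q ^ k).
Proof.
by move=> nMk; rewrite -[LHS]/(qp (Posz M) (qp n z)) qpowA addrC nMk.
Qed.

Lemma ler_abs_qpow n x y : (a (qp n x) <= a (qp n y)) = (a x <= a y).
Proof.
elim/int_ind_succ: n => [|n IH|n IH]; first by rewrite !qpow0.
  by rewrite !qpow_succ !absX ler_pXn2r ?nnegrE ?abs_ge0.
by rewrite -IH !qpow_succ !absX ler_pXn2r ?nnegrE ?abs_ge0.
Qed.

Lemma ltr_abs_qpow n x y : (a (qp n x) < a (qp n y)) = (a x < a y).
Proof. by rewrite !ltNge ler_abs_qpow. Qed.

Lemma abs_qpow_eq n x y : a x = a y -> a (qp n x) = a (qp n y).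
Proof. by move=> xy; apply/eqP; rewrite eq_le !ler_abs_qpow xy lexx. Qed.

Lemma abs_qpow_le_index n m x : 1 <= a x -> n <= m -> a (qp n x) <= a (qp m x).
Proof.
move=> x1 nm; have [k ->] : exists k : nat, m = k%:Z + n by exists (absz (m - n)); lia.
rewrite -qpowA /= absX -(prednK (_ : 0 < q ^ k)%N) ?expn_gt0 ?q_gt0//.
rewrite exprS ler_peMr// exprn_ege1//.
by rewrite -(abs1 a) -(qpow_1 n) ler_abs_qpow abs1.
Qed.

Lemma abs_qpow_lt_index n m x : 1 < a x -> n < m -> a (qp n x) < a (qp m x).
Proof.
move=> x1 nm; have [k ->] : exists k : nat, m = k.+1%:Z + n.
  by exists (absz (m - n)).-1; lia.
have x1n : 1 < a (qp n x) by rewrite -(abs1 a) -(qpow_1 n) ltr_abs_qpow abs1.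
rewrite -qpowA /= absX -(prednK (_ : 0 < q ^ k.+1)%N) ?expn_gt0 ?q_gt0//.
rewrite exprS ltr_pMr ?(lt_trans ltr01)// exprn_egt1//.
by rewrite -lt0n -subn1 subn_gt0 (leq_trans q_gt1)// -[leqLHS]expn1 leq_exp2l.
Qed.

(** For [|x| > 1] the powers grow strictly with the index; the case [|x| < 1] follows by
    inversion. *)
Lemma abs_qpow_index_eq n m x : n != m -> x != 0 -> a (qp n x) = a (qp m x) -> a x = 1.
Proof.
wlog nm : n m / n < m => [hw nm x0 nmE|_ x0 nmE].
  case/orP: (lt_total nm) => lt; first exact: (hw n m).
  by apply: (hw m n) => //; rewrite eq_sym.
have [x1|x1|//] := ltgtP (a x) 1.
  have : 1 < a x^-1 by rewrite absV invf_gt1 ?abs_gt0.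
  by move=> /abs_qpow_lt_index/(_ nm); rewrite !qpowV !absV nmE ltxx.
by have := abs_qpow_lt_index x1 nm; rewrite nmE ltxx.
Qed.

Lemma qpow_small n (eps : R) : 0 < eps ->
  exists2 d : R, 0 < d & forall x, a x < d -> a (qp n x) < eps.
Proof.
elim/int_ind_succ: n eps => [|n IH|n IH] eps eps0.
- by exists eps => // x; rewrite qpow0.
- have [|d d0 xd] := IH (Num.min 1 eps); first by rewrite lt_min ltr01.
  exists d => // x /xd; rewrite lt_min qpow_succ absX => /andP[x1 xe].
  rewrite (le_lt_trans _ xe)// -[leRHS]expr1 ler_wiXn2l// ltW//.
- have [|d d0 xd] := IH (eps ^+ q); first by rewrite exprn_gt0.
  exists d => // x /xd; rewrite qpow_succ absX.
  by rewrite ltr_pXn2r ?nnegrE ?abs_ge0 ?(ltW eps0)//.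
Qed.

(** * Two-sided sums *)

Implicit Types u v : int -> K.

Definition vanish u : Prop := forall eps : R, 0 < eps ->
  exists N, forall n, (N <= `|n|)%N -> a (u n) < eps.

(** [Negz k] is [- k - 1], so the window of indices runs from [- M] to [M - 1]. *)
Definition psum u (M : nat) : K := \sum_(k < M) (u (Posz k) + u (Negz k)).

Lemma psumS u M : psum u M.+1 = psum u M + (u (Posz M) + u (Negz M)).
Proof. by rewrite /psum big_ord_recr. Qed.

Lemma tends_series (u : nat -> K) :
  (forall eps : R, 0 < eps -> exists N, forall n : nat, (N <= n)%N -> a (u n) < eps) ->
  tends (series u) (limn (series u)).
Proof.
move=> u0; have [l ul] : exists l, tends (series u) l.
  apply: tends_cauchy => // eps /u0[N uN]; exists N => n Nn.
  by rewrite /series /= big_nat_recr//= addrAC subrr add0r ltW ?uN.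
by rewrite (tends_lim ul).
Qed.

(** In a complete ultrametric field a series converges as soon as its terms tend to 0; this is
    applied to both halves. *)
Lemma cvg_zsumP u : cvg_zsum u <-> vanish u.
Proof.
have term (w : nat -> K) : cvgn (series w) -> forall eps : R, 0 < eps ->
    exists N, forall n : nat, (N <= n)%N -> a (w n) < eps.
  move=> /tendsP wl eps eps0; have [N wN] := wl _ eps0; exists N => n Nn.
  have -> : w n = (series w n.+1 - limn (series w)) - (series w n - limn (series w)).
    by rewrite /series /= big_nat_recr//=; ring.
  by rewrite absB_lt ?wN// ltnW.
split=> [[up un] eps eps0|u0].
  have [[N uN] [M uM]] := (term _ up _ eps0, term _ un _ eps0).
  exists (maxn N M).+1 => -[k|k] /=; first by move=> kN; apply: uN; lia.
  by move=> kM; apply: uM; lia.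
split; apply/tendsP; apply: tends_series => eps /u0[N uN]; exists N => n Nn;
  by apply: uN; lia.
Qed.

Lemma zsum_tends u : vanish u -> tends (psum u) (zsum u).
Proof.
move=> u0; apply: (@tends_eventually _ _ _
    (fun M => series (fun k => u (Posz k)) M + series (fun k => u (Negz k)) M) _ _ 0%N).
  by move=> M _; rewrite /psum /series /= !big_mkord big_split.
by apply: tendsD; apply: tends_series => eps /u0[N uN]; exists N => n Nn;
  apply: uN; lia.
Qed.

Lemma zsum_eq u l : vanish u -> tends (psum u) l -> zsum u = l.
Proof. by move=> /zsum_tends ul; exact: tends_unique. Qed.

Lemma vanish_le u v : (forall n, a (v n) <= a (u n)) -> vanish u -> vanish v.
Proof.
by move=> vu u0 eps /u0[N uN]; exists N => n /uN; exact: le_lt_trans.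
Qed.

Lemma vanishD u v : vanish u -> vanish v -> vanish (fun n => u n + v n).
Proof.
move=> u0 v0 eps eps0; have [[N uN] [M vM]] := (u0 _ eps0, v0 _ eps0).
by exists (maxn N M) => n Hn; rewrite absD_lt ?uN ?vM//; lia.
Qed.

Lemma vanishN u : vanish u -> vanish (fun n => - u n).
Proof. by apply: vanish_le => n; rewrite absN. Qed.

Lemma vanishB u v : vanish u -> vanish v -> vanish (fun n => u n - v n).
Proof. by move=> u0 v0; apply: vanishD => //; exact: vanishN. Qed.

Lemma vanish_shift u m : vanish u -> vanish (fun n => u (n + m)).
Proof. by move=> u0 eps /u0[N uN]; exists (N + `|m|)%N => n Hn; apply: uN; lia. Qed.

Lemma vanish_finite u N : (forall n, (N <= `|n|)%N -> u n = 0) -> vanish u.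
Proof. by move=> u0 eps eps0; exists N => n /u0 ->; rewrite abs0. Qed.

Lemma vanish_additive (phi : K -> K) u :
  (forall eps : R, 0 < eps ->
     exists2 d : R, 0 < d & forall x, a x < d -> a (phi x) < eps) ->
  vanish u -> vanish (fun n => phi (u n)).
Proof.
by move=> phi0 u0 eps /phi0[d /u0[N uN] phid]; exists N => n /uN; exact: phid.
Qed.

Lemma zsumD u v : vanish u -> vanish v ->
  zsum (fun n => u n + v n) = zsum u + zsum v.
Proof.
move=> u0 v0; apply: zsum_eq; first exact: vanishD.
apply: (tends_eventually (N := 0%N) _ (tendsD (zsum_tends u0) (zsum_tends v0))).
by move=> n _; rewrite /psum -big_split; apply: eq_bigr => i _ /=; ring.
Qed.

Lemma zsum_additive (phi : K -> K) u :
  (forall x y, phi (x + y) = phi x + phi y) ->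
  (forall eps : R, 0 < eps ->
     exists2 d : R, 0 < d & forall x, a x < d -> a (phi x) < eps) ->
  vanish u -> zsum (fun n => phi (u n)) = phi (zsum u).
Proof.
move=> phiD phi_small u0.
have phi0 : phi 0 = 0 by apply: (addrI (phi 0)); rewrite -phiD !addr0.
have phiN x : phi (- x) = - phi x.
  by apply: (addrI (phi x)); rewrite -phiD !subrr.
apply: zsum_eq; first exact: vanish_additive.
have := tends_additive _ phi_small (zsum_tends u0).
move=> /(_ (fun x y => etrans (phiD x (- y)) (congr1 _ (phiN y)))).
apply: (@tends_eventually _ _ _ _ _ _ 0%N) => n _.
by rewrite /psum (big_morph phi phiD phi0); apply: eq_bigr => i _.
Qed.

Lemma mulr_small (c : K) (eps : R) : 0 < eps ->
  exists2 d : R, 0 < d & forall x, a x < d -> a (c * x) < eps.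
Proof.
move=> eps0; have c1 : 0 < a c + 1 by rewrite ltr_wpDl.
exists (eps / (a c + 1)); first by rewrite divr_gt0.
move=> x; rewrite ltr_pdivlMr// absM; apply: le_lt_trans.
by rewrite mulrC ler_wpM2l// lerDl.
Qed.

Lemma zsumZ (c : K) u : vanish u -> zsum (fun n => c * u n) = c * zsum u.
Proof. by apply: zsum_additive (mulr_small c) => x y; exact: mulrDr. Qed.

Lemma zsumN u : vanish u -> zsum (fun n => - u n) = - zsum u.
Proof.
move=> u0; rewrite -mulN1r -zsumZ//; congr zsum; apply/funext => n.
by rewrite mulN1r.
Qed.

Lemma zsumB u v : vanish u -> vanish v ->
  zsum (fun n => u n - v n) = zsum u - zsum v.
Proof. by move=> u0 v0; rewrite zsumD ?zsumN//; exact: vanishN. Qed.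

Lemma zsum_abs_le u B : vanish u -> (forall n, a (u n) <= B) -> a (zsum u) <= B.
Proof.
move=> u0 uB; apply: (tends_abs_le (N := 0%N) _ (zsum_tends u0)) => n _.
apply: abs_sum_le => [|i _]; first exact: le_trans (uB 0).
by rewrite absD_le.
Qed.

Lemma zsum_succ u : vanish u -> zsum (fun n => u (n + 1)) = zsum u.
Proof.
move=> u0; apply: zsum_eq; first exact: vanish_shift.
(* Shifting the index changes the window only at its two ends, by terms that tend to 0. *)
have psumE M : psum (fun n => u (n + 1)) M = psum u M + (u (Posz M) - u (- M%:Z)).
  elim: M => [|M IH]; first by rewrite /psum !big_ord0 oppr0 subrr addr0.
  rewrite !psumS IH -[Posz M + 1]PoszD addn1.
  have -> : Negz M + 1 = - M%:Z by lia.
  by rewrite NegzE; ring.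
have -> : zsum u = zsum u + 0 by rewrite addr0.
apply: (tends_eventually (N := 0%N) (fun M _ => esym (psumE M))).
apply: tendsD; first exact: zsum_tends.
move=> eps /u0[N uN]; exists N => n Nn.
by rewrite subr0 absB_lt ?uN//; lia.
Qed.

Lemma zsum_shift u m : vanish u -> zsum (fun n => u (n + m)) = zsum u.
Proof.
move=> u0; elim/int_ind_succ: m => [|m <-|m <-].
- by congr zsum; apply/funext => n; rewrite addr0.
- rewrite -[RHS]zsum_succ; last exact: vanish_shift.
  by congr zsum; apply/funext => n; congr u; ring.
- rewrite -[LHS]zsum_succ; last exact: vanish_shift.
  by congr zsum; apply/funext => n; congr u; ring.
Qed.

Lemma zsum_finite u N : (forall k, (N <= k)%N -> u (Posz k) = 0 /\ u (Negz k) = 0) ->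
  zsum u = psum u N.
Proof.
move=> u0; apply: zsum_eq.
  by apply: (@vanish_finite _ N.+1) => -[k|k] /= kN; have [] := u0 k; rewrite //; lia.
apply: (@tends_eventually _ _ _ (fun=> psum u N) _ _ N); last exact: tends_cst.
move=> n; elim: n => [|n IH]; first by rewrite leqn0 => /eqP ->.
rewrite leq_eqVlt => /orP[/eqP ->//|]; rewrite ltnS => Nn.
by rewrite psumS -IH//; have [-> ->] := u0 _ Nn; rewrite !addr0.
Qed.

Lemma zsum1 u m : (forall n, n != m -> u n = 0) -> zsum u = u m.
Proof.
move=> u0; have uv : vanish u.
  by apply: (@vanish_finite _ `|m|.+1) => n nm; apply: u0; lia.
rewrite -(zsum_shift m uv) (@zsum_finite _ 1%N).
  rewrite /psum big_ord1 add0r [u (Negz 0 + m)]u0 ?addr0//.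
  by rewrite eq_sym -subr_eq0 opprD addrCA subrr addr0.
by move=> k k1; rewrite !u0//; apply/eqP; lia.
Qed.

(** Outside a finite window all terms are smaller than one fixed nonzero term, so the maximum is
    taken over a finite list. *)
Lemma vanish_argmax u : vanish u -> exists m, forall n, a (u n) <= a (u m).
Proof.
move=> u0; have [allz|/existsNP[j /eqP uj]] := pselect (forall n, u n = 0).
  by exists 0 => n; rewrite !allz.
have [|N uN] := u0 (a (u j)); first by rewrite abs_gt0.
pose s := map Posz (iota 0 N) ++ map (fun k => - Posz k) (iota 0 N).
have ms n : (`|n| < N)%N -> n \in s.
  move=> nN; rewrite mem_cat; apply/orP; case: n nN => k /= kN.
    by left; rewrite map_f// mem_iota.
  by right; apply/mapP; exists k.+1; rewrite ?mem_iota//; lia.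
have js : j \in s by apply: ms; rewrite ltnNge; apply/negP => /uN; rewrite ltxx.
have [|m _ mmax] := seq_argmax (fun n => a (u n)) (s := s).
  by case: (s) js.
exists m => n; have [nN|nN] := ltnP `|n| N; first exact/mmax/ms.
exact: le_trans (ltW (uN _ nN)) (mmax _ js).
Qed.

Lemma zsum_dominant u m : vanish u -> (forall n, n != m -> a (u n) < a (u m)) ->
  a (zsum u) = a (u m).
Proof.
move=> u0 um; have [um0|um0] := eqVneq (u m) 0.
  rewrite (@zsum1 u m)// => n /um; rewrite um0 abs0 => h.
  by have := lt_le_trans h (abs_ge0 (u n)); rewrite ltxx.
pose v n := if n == m then 0 else u n; pose w n := if n == m then u m else 0.
have v0 : vanish v.
  by apply: vanish_le u0 => n; rewrite /v; case: eqP => // _; rewrite abs0.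
have w0 : vanish w.
  by apply: vanish_le u0 => n; rewrite /w; case: eqP => [->//|_]; rewrite abs0.
have -> : u = fun n => w n + v n.
  by apply/funext => n; rewrite /w /v; case: eqP => [->|_]; rewrite ?addr0 ?add0r.
rewrite zsumD// (@zsum1 w m) /w ?eqxx//; last by move=> n /negPf ->.
rewrite [v m]/v eqxx addr0 abs_domD//.
have [k kmax] := vanish_argmax v0; apply: le_lt_trans (zsum_abs_le v0 kmax) _.
by rewrite /v; case: eqP => [_|/eqP/um//]; rewrite abs0 abs_gt0.
Qed.

(** * Evaluation and Gauss norms *)

Local Notation ev := (@tau_eval R C0 a q).
Local Notation cF := (@calF R C0 a q).
Implicit Types f g : tau_series a.

Lemma calFP f : cF f <-> forall z, vanish (tau_terms q f z).
Proof. by split=> fF z; apply/cvg_zsumP/fF. Qed.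

Lemma calFB f g : cF f -> cF g -> cF (fun n => f n - g n).
Proof.
move=> /calFP fF /calFP gF; apply/calFP => z eps eps0.
have [N fgN] := vanishB (fF z) (gF z) eps0; exists N => n /fgN.
by rewrite /tau_terms mulrBl.
Qed.

Lemma evB f g z : cF f -> cF g -> ev (fun n => f n - g n) z = ev f z - ev g z.
Proof.
move=> /calFP fF /calFP gF; rewrite /tau_eval -zsumB//; congr zsum.
by apply/funext => n; rewrite /tau_terms mulrBl.
Qed.

Lemma evDr f z w : cF f -> ev f (z + w) = ev f z + ev f w.
Proof.
move=> /calFP fF; rewrite /tau_eval -zsumD//; congr zsum.
by apply/funext => n; rewrite /tau_terms qpowD mulrDr.
Qed.

Lemma ev0r f : cF f -> ev f 0 = 0.
Proof. by move=> fF; apply: (addrI (ev f 0)); rewrite -evDr// !addr0. Qed.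

Lemma evNr f z : cF f -> ev f (- z) = - ev f z.
Proof. by move=> fF; apply: (addrI (ev f z)); rewrite -evDr// !subrr ev0r. Qed.

Lemma evBr f z w : cF f -> ev f (z - w) = ev f z - ev f w.
Proof. by move=> fF; rewrite evDr// evNr. Qed.

Lemma evZr f (c : K) z : cF f -> c ^+ q = c -> ev f (c * z) = c * ev f z.
Proof.
move=> /calFP fF cq; rewrite /tau_eval -zsumZ//; congr zsum.
by apply/funext => n; rewrite /tau_terms qpowM (qpow_fixed _ cq) mulrCA.
Qed.

(* The coefficients of (c tau^k) o f. *)
Definition tau_lmul (c : K) (k : int) f : tau_series a :=
  fun n => c * qp k (f (n - k)).

Lemma tau_comp_mono c k f : tau_comp q (tau_mono c k) f = tau_lmul c k f.
Proof.
apply/funext => n; rewrite /tau_comp (@zsum1 _ k) /tau_mono ?eqxx//.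
by move=> i /negPf ->; rewrite mul0r.
Qed.

Lemma tau_lmul_term c k f z n :
  tau_terms q (tau_lmul c k f) z n = c * qp k (tau_terms q f z (n - k)).
Proof. by rewrite /tau_terms /tau_lmul qpowM qpowA [k + _]addrC subrK mulrA. Qed.

Lemma calF_lmul c k f : cF f -> cF (tau_lmul c k f).
Proof.
move=> /calFP fF; apply/calFP => z; have -> : tau_terms q (tau_lmul c k f) z =
    (fun n => c * qp k (tau_terms q f z (n + - k))).
  by apply/funext => n; rewrite tau_lmul_term.
apply: (vanish_additive (mulr_small c)); apply: (vanish_additive (qpow_small k)).
exact: vanish_shift.
Qed.

Lemma ev_lmul c k f z : cF f -> ev (tau_lmul c k f) z = c * qp k (ev f z).
Proof.
move=> /calFP fF; have fz := vanish_shift (- k) (fF z); rewrite /tau_eval.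
have -> : tau_terms q (tau_lmul c k f) z =
    (fun n => c * qp k (tau_terms q f z (n + - k))).
  by apply/funext => n; rewrite tau_lmul_term.
rewrite zsumZ; last by apply: (vanish_additive (qpow_small k)).
rewrite (zsum_additive (qpowD k) (qpow_small k))//.
by rewrite (zsum_shift (- k) (fF z)).
Qed.

(** The radius is carried by a point [z], so that [|z| ^ (q ^ n)] is the absolute value of a field
    element for negative [n] as well. *)
Definition gauss_le f z (B : R) : Prop := forall n, a (f n * qp n z) <= B.

Lemma gauss_le_trans f z B B' : B <= B' -> gauss_le f z B -> gauss_le f z B'.
Proof. by move=> BB' fB n; exact: le_trans BB'. Qed.

Lemma gauss_le_sub f z w B : a w <= a z -> gauss_le f z B -> gauss_le f w B.
Proof.
move=> wz fB n; apply: le_trans (fB n).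
by rewrite !absM ler_wpM2l// ler_abs_qpow.
Qed.

Lemma ev_gauss f z B : cF f -> gauss_le f z B -> a (ev f z) <= B.
Proof. by move=> /calFP fF fB; apply: zsum_abs_le. Qed.

Lemma gauss_leB f g z B : gauss_le f z B -> gauss_le g z B ->
  gauss_le (fun n => f n - g n) z B.
Proof. by move=> fB gB n; rewrite mulrBl absB_le. Qed.

Lemma gauss_leDr f z w B : gauss_le f z B -> gauss_le f w B -> gauss_le f (z + w) B.
Proof. by move=> fz fw n; rewrite qpowD mulrDr absD_le. Qed.

Lemma gauss_argmax f z : cF f -> exists m, gauss_le f z (a (f m * qp m z)).
Proof. by move=> /calFP /(_ z)/vanish_argmax[m mmax]; exists m. Qed.

Lemma gauss_le_lmul c k f z (w : K) : gauss_le f z (a w) ->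
  gauss_le (tau_lmul c k f) z (a (c * qp k w)).
Proof.
move=> fw n; have := tau_lmul_term c k f z n; rewrite /tau_terms => ->.
by rewrite absM [leRHS]absM ler_wpM2l// ler_abs_qpow.
Qed.

(** Terms with [|n|] large are below [eps] at 1, hence on the unit disc; each of the finitely many
    others is continuous at 0. *)
Lemma ev_small f (eps : R) : cF f -> 0 < eps ->
  exists2 d : R, 0 < d & forall z, a z < d -> gauss_le f z eps.
Proof.
move=> /calFP fF eps0; have [N fN] := fF 1 _ eps0.
have [d d0 dP] : exists2 d : R, 0 < d &
    forall n, (`|n| < N)%N -> forall z, a z < d -> a (f n * qp n z) < eps.
  have low n : exists2 d : R, 0 < d & forall z, a z < d -> a (f n * qp n z) < eps.
    have [d d0 dP] := mulr_small (f n) eps0.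
    by have [d' d'0 d'P] := qpow_small n d0; exists d' => // z /d'P/dP.
  elim: N {fN} => [|N [d d0 dP]]; first by exists 1.
  have [[d1 d10 d1P] [d2 d20 d2P]] := (low (Posz N), low (- Posz N)).
  exists (Num.min d (Num.min d1 d2)); first by rewrite !lt_min d0 d10.
  move=> n; rewrite ltnS leq_eqVlt => /orP[/eqP nN|nN] z; last first.
    by rewrite !lt_min => /and3P[zd _ _]; exact: dP.
  rewrite !lt_min => /and3P[_ zd1 zd2].
  have [-> | ->] : n = Posz N \/ n = - Posz N by lia.
    exact: d1P.
  exact: d2P.
exists (Num.min 1 d); first by rewrite lt_min ltr01.
move=> z; rewrite lt_min => /andP[/ltW z1 zd] n.
have [nN|nN] := ltnP `|n| N; first exact/ltW/dP.
apply: le_trans (ltW (fN _ nN)); rewrite /tau_terms !absM ler_wpM2l//.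
by rewrite ler_abs_qpow abs1.
Qed.

Lemma ev_tends f (u : nat -> K) l : cF f -> tends u l ->
  tends (fun k => ev f (u k)) (ev f l).
Proof.
move=> fF; apply: tends_additive => [x y|eps eps0]; first exact: evBr.
have [|d d0 dP] := @ev_small f (eps / 2) fF; first by rewrite divr_gt0.
exists d => // x /dP/(ev_gauss fF)/le_lt_trans; apply.
exact: half_lt.
Qed.

(** * Completeness of [calF] for the Gauss norms *)

Definition gauss_cvg (f_ : nat -> tau_series a) f : Prop :=
  forall z (eps : R), 0 < eps -> exists N, forall k, (N <= k)%N ->
    gauss_le (fun n => f n - f_ k n) z eps.

Lemma gauss_cvg_ev (f_ : nat -> tau_series a) f z :
  (forall k, cF (f_ k)) -> cF f -> gauss_cvg f_ f ->
  tends (fun k => ev (f_ k) z) (ev f z).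
Proof.
move=> f_F fF ff eps eps0; have [|N fN] := ff z (eps / 2).
  by rewrite divr_gt0.
exists N => k /fN /(ev_gauss (calFB fF (f_F k))); rewrite evB// absBC => /le_lt_trans.
by apply; exact: half_lt.
Qed.

Lemma gauss_cvg_coef (f_ : nat -> tau_series a) f n :
  gauss_cvg f_ f -> tends (fun k => f_ k n) (f n).
Proof.
move=> ff eps eps0; have [|N fN] := ff 1 (eps / 2); first by rewrite divr_gt0.
exists N => k /fN/(_ n); rewrite qpow_1 mulr1 absBC => /le_lt_trans; apply.
exact: half_lt.
Qed.

(** At [z = 1] all powers are 1, which gives convergence of each coefficient; the ultrametric bound
    on differences then passes to the limit uniformly in the index. *)
Lemma gauss_cauchy (f_ : nat -> tau_series a) : (forall k, cF (f_ k)) ->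
  (forall z (eps : R), 0 < eps -> exists N, forall k, (N <= k)%N ->
     gauss_le (fun n => f_ k.+1 n - f_ k n) z eps) ->
  exists2 f, cF f & gauss_cvg f_ f.
Proof.
move=> f_F fC.
have /choice[f fP] : forall n, exists l, tends (fun k => f_ k n) l.
  move=> n; apply: tends_cauchy => // eps eps0; have [N fN] := fC 1 _ eps0.
  by exists N => k /fN/(_ n); rewrite qpow_1 mulr1.
have ff : gauss_cvg f_ f.
  move=> z eps eps0; have [N fN] := fC z _ eps0; exists N => k Nk n.
  have := tends_additive (fun x y => mulrBl (qp n z) x y) _ (fP n).
  have small (e : R) : 0 < e -> exists2 d : R, 0 < d &
      forall x, a x < d -> a (x * qp n z) < e.
    move=> /(mulr_small (qp n z))[d d0 dP].
    by exists d => // x; rewrite mulrC; exact: dP.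
  move=> /(_ small) fz.
  have := tendsD fz (tends_cst (- (f_ k n * qp n z))); rewrite -mulrBl.
  apply: (@tends_abs_le _ _ _ _ _ _ k) => m km.
  apply: (@abs_step_le _ _ _ (fun j : nat => f_ j n * qp n z) _ N) => // j Nj.
  by rewrite -mulrBl; exact: fN.
exists f => //; apply/calFP => z eps eps0.
have [|N fN] := ff z (eps / 2); first by rewrite divr_gt0.
have [M fM] := (calFP _).1 (f_F N) z _ eps0; exists M => n /fM fMn.
have -> : tau_terms q f z n = (f n - f_ N n) * qp n z + tau_terms q (f_ N) z n.
  by rewrite /tau_terms; ring.
rewrite absD_lt// (le_lt_trans (fN _ (leqnn _) n))//.
exact: half_lt.
Qed.

(** * Solving f w = y *)

Lemma psum_centered u N : psum u N = \sum_(k < N.*2) u (k%:Z - N%:Z).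
Proof.
elim: N => [|N IH]; first by rewrite /psum !big_ord0.
rewrite psumS IH doubleS big_ord_recr big_ord_recl /=.
have -> : (0 : int) - N.+1%:Z = Negz N by lia.
have -> : N.*2.+1%:Z - N.+1%:Z = Posz N by lia.
have -> : \sum_(i < N.*2) u ((bump 0 i)%:Z - N.+1%:Z) = \sum_(k < N.*2) u (k%:Z - N%:Z).
  by apply: eq_bigr => i _; congr u; rewrite /bump leq0n; lia.
by ring.
Qed.

Definition tau_supp f N : Prop :=
  forall k, (N <= k)%N -> f (Posz k) = 0 /\ f (Negz k) = 0.

Lemma tau_supp_index f N n : tau_supp f N -> f n != 0 ->
  exists2 k : nat, (k < N.*2)%N & n = k%:Z - N%:Z.
Proof.
move=> fN fn; exists (absz (n + N%:Z)); case: n fn => k fk; have kN : (k < N)%N;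
  by [rewrite ltnNge; apply/negP => /fN[f1 f2]; rewrite ?f1 ?f2 eqxx in fk | lia].
Qed.

Lemma tau_supp_calF f N : tau_supp f N -> cF f.
Proof.
move=> fN; apply/calFP => z; apply: (@vanish_finite _ N.+1) => n nN.
apply/eqP; rewrite mulf_eq0; have [//|/(tau_supp_index fN)[k]] := eqVneq (f n) 0; lia.
Qed.

Lemma ev_tau_supp f N z : tau_supp f N ->
  ev f z = \sum_(k < N.*2) f (k%:Z - N%:Z) * qp (k%:Z - N%:Z) z.
Proof.
move=> fN; rewrite /tau_eval (@zsum_finite _ N) ?psum_centered//.
by move=> k /fN[fp fn]; rewrite /tau_terms fp fn !mul0r.
Qed.

(* The polynomial function z |-> (f z) ^ (q ^ N), for f supported in [-N, N[. *)
Definition tau_poly f N : {poly K} :=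
  \sum_(k < N.*2) (f (k%:Z - N%:Z) ^+ (q ^ N)) *: 'X^(q ^ k).

Lemma tau_poly_horner f N z : tau_supp f N -> (tau_poly f N).[z] = ev f z ^+ (q ^ N).
Proof.
move=> fN; rewrite (ev_tau_supp _ fN) /tau_poly horner_sum.
have e0 : (0 : K) ^+ (q ^ N) = 0.
  by rewrite expr0n expn_eq0 -leqn0 leqNgt q_gt0.
rewrite (big_morph (fun x : K => x ^+ (q ^ N)) (fun x y => exprqD x y N) e0).
apply: eq_bigr => k _; rewrite hornerZ hornerXn exprMn; congr (_ * _).
by rewrite (@qpow_expr _ _ k)//; lia.
Qed.

Lemma tau_poly_coef f N (k : nat) : (k < N.*2)%N ->
  (tau_poly f N)`_(q ^ k) = f (k%:Z - N%:Z) ^+ (q ^ N).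
Proof.
move=> kN; rewrite /tau_poly coef_sum (bigD1 (Ordinal kN))//= coefZ coefXn eqxx mulr1.
rewrite big1 ?addr0// => i ik; rewrite coefZ coefXn eqn_exp2l//.
by rewrite -(inj_eq val_inj) /= eq_sym in ik; rewrite (negPf ik) mulr0.
Qed.

Lemma tau_poly_coef0 f N : (tau_poly f N)`_0 = 0.
Proof.
rewrite /tau_poly coef_sum big1// => k _; rewrite coefZ coefXn.
by rewrite eq_sym expn_eq0 -leqn0 leqNgt q_gt0 mulr0.
Qed.

(** The coefficient of degree [j] is up to sign a sum of products omitting [j] roots, and [|w| ^ j]
    is at most the product of the absolute values of the omitted ones. *)
Lemma prod_roots_coef_le (s : seq K) w j : (forall z, z \in s -> a w <= a z) ->
  a ((\prod_(z <- s) ('X - z%:P))`_j) * a w ^+ j <= \prod_(z <- s) a z.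
Proof.
elim: s j => [|z s IH] j ws.
  rewrite !big_nil coef1; case: j => [|j]; first by rewrite abs1 mulr1.
  by rewrite abs0 mul0r.
have wz : a w <= a z by apply: ws; rewrite mem_head.
have {}IH k := IH k (fun y ys => ws y (mem_behead (s := z :: s) ys)).
have s0 : 0 <= \prod_(z <- s) a z by apply: prodr_ge0.
rewrite !big_cons mulrBl coefB coefXM coefCM -!absX -absM mulrBl absB_le//.
  case: j => [|j] /=; first by rewrite mul0r abs0 mulr_ge0.
  by rewrite exprS mulrCA absM ler_pM// absM absX.
by rewrite -mulrA absM ler_wpM2l// absM absX.
Qed.

(* Among the solutions of f w = y, one of minimal absolute value works. *)
Lemma tau_supp_solve f N n0 y : tau_supp f N -> f n0 != 0 ->
  exists2 w, ev f w = y & gauss_le f w (a y).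
Proof.
move=> fN fn0; pose P := tau_poly f N - (y ^+ (q ^ N))%:P.
have qk (k : nat) : (q ^ k == 0)%N = false by rewrite expn_eq0 -leqn0 leqNgt q_gt0.
have Pk (k : nat) : (k < N.*2)%N -> P`_(q ^ k) = f (k%:Z - N%:Z) ^+ (q ^ N).
  by move=> kN; rewrite /P coefB coefC qk subr0 tau_poly_coef.
have [k0 k0N n0E] := tau_supp_index fN fn0.
have [r Pr] := closed_field_poly_normal P.
have r0 : r != [::].
  apply: contraNneq fn0 => r0; move: (Pk _ k0N).
  rewrite Pr r0 big_nil coefZ coef1 qk mulr0 -n0E => /esym/eqP.
  by rewrite expf_eq0 => /andP[].
have [w wr wmin] := seq_argmin (fun z => a z) r0.
have yw : ev f w = y.
  apply: (@exprq_inj N); rewrite -tau_poly_horner//; apply/eqP.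
  rewrite -subr_eq0 -(hornerC (y ^+ _) w) -hornerN -hornerD -/P Pr hornerZ mulf_eq0.
  by rewrite -[_.[w] == 0]/(root _ w) root_prod_XsubC wr orbT.
exists w => // n; have [->|fn] := eqVneq (f n) 0; first by rewrite mul0r abs0.
have [k kN nE] := tau_supp_index fN fn.
have qN0 : (0 < q ^ N)%N by rewrite expn_gt0 q_gt0.
rewrite -(@ler_pXn2r _ (q ^ N)) ?nnegrE// -!absX exprMn nE -Pk// -nE.
rewrite (@qpow_expr _ _ k); last by rewrite nE; lia.
(* As [w] is a root of minimal absolute value, each such monomial of [P] at [w] is bounded by the
   constant coefficient, which is [- y ^ (q ^ N)]. *)
have : a (P`_(q ^ k)) * a w ^+ (q ^ k) <= a (P`_0).
  rewrite Pr !coefZ !absM -mulrA ler_wpM2l//.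
  apply: le_trans (prod_roots_coef_le _ wmin) _.
  elim: (r) => [|z s IH]; first by rewrite !big_nil coef1 abs1.
  by rewrite !big_cons mulrBl coefB coefXM coefCM sub0r absN absM ler_wpM2l.
have -> : P`_0 = - y ^+ (q ^ N) by rewrite /P coefB tau_poly_coef0 coefC sub0r.
by rewrite absN -absX -absM.
Qed.

(** If all roots of [tau_poly f N] were 0, it would be a single monomial, whereas two nonzero
    coefficients of [f] show up in two different degrees. *)
Lemma tau_supp_nontrivial_root f N n m : tau_supp f N -> n != m ->
  f n != 0 -> f m != 0 -> exists2 z, z != 0 & ev f z = 0.
Proof.
move=> fN nm fn fm; have [k kN nE] := tau_supp_index fN fn.
have [l lN mE] := tau_supp_index fN fm.
have [r Pr] := closed_field_poly_normal (tau_poly f N).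
have [r0|/allPn[z zr z0]] := boolP (all (pred1 0) r); last first.
  exists z => //; apply/eqP; have qN0 : (0 < q ^ N)%N by rewrite expn_gt0 q_gt0.
  have := tau_poly_horner z fN; rewrite Pr hornerZ => /esym/eqP.
  have /eqP -> : (\prod_(z <- r) ('X - z%:P)).[z] == 0.
    by rewrite -[_ == 0]/(root _ z) root_prod_XsubC.
  by rewrite mulr0 expf_eq0 qN0.
have rX : \prod_(z <- r) ('X - z%:P) = 'X^(size r) :> {poly K}.
  elim: (r) r0 => [|z s IH]; first by rewrite big_nil.
  by move=> /andP[/eqP -> /IH]; rewrite big_cons subr0 exprS => ->.
have key (j : nat) n1 : (j < N.*2)%N -> n1 = j%:Z - N%:Z -> f n1 != 0 ->
    (q ^ j)%N = size r.
  move=> jN -> fj; apply/eqP; apply: contraNT fj => jr.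
  have := tau_poly_coef f jN; rewrite Pr rX coefZ coefXn (negPf jr) mulr0.
  by move=> /esym/eqP; rewrite expf_eq0 => /andP[].
have /eqP := etrans (key k n kN nE fn) (esym (key l m lN mE fm)).
by rewrite eqn_exp2l// => /eqP kl; rewrite nE mE kl eqxx in nm.
Qed.

Lemma gauss_le_arg f n w y : f n != 0 -> gauss_le f w (a y) ->
  a w <= a (qp (- n) (y / f n)).
Proof.
move=> fn /(_ n); rewrite -(ler_abs_qpow n w) qpowVK absf absM.
by rewrite ler_pdivlMr ?abs_gt0// mulrC.
Qed.

Lemma tau_approx_solve f n0 y : cF f -> f n0 != 0 ->
  exists w, gauss_le f w (a y) /\ a (y - ev f w) <= a y / 2.
Proof.
move=> fF fn0; have [->|y0] := eqVneq y 0.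
  exists 0; rewrite ev0r// subr0 abs0 mul0r; split => // n.
  by rewrite qpow_0 mulr0 abs0.
(* [x] solves the equation for the single term [n0]. By [gauss_le_arg] a controlled solution is at
   most [|x|] in absolute value, so a tail estimate at [x] fixes the truncation before [w] is
   known. *)
pose x := qp (- n0) (y / f n0).
have fx : f n0 * qp n0 x = y by rewrite qpowVK mulrC divfK.
have ay : 0 < a y by rewrite abs_gt0.
have [|N fN] := (calFP f).1 fF x (a y / 2); first by rewrite divr_gt0.
pose g : tau_series a := fun n => if (`|n| < N)%N then f n else 0.
have gN : tau_supp g N.
  by move=> k Nk; rewrite /g; split; case: ifP => //; lia.
have n0N : (`|n0| < N)%N.
  rewrite ltnNge; apply/negP => /fN; rewrite /tau_terms fx.
  by move=> /(lt_trans (half_lt ay)); rewrite ltxx.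
have gn0 : g n0 != 0 by rewrite /g n0N.
have [w gw gwy] := tau_supp_solve y gN gn0.
have wx : a w <= a x by have := gauss_le_arg gn0 gwy; rewrite /g n0N.
have tail n : (N <= `|n|)%N -> a (f n * qp n w) <= a y / 2.
  move=> nN; apply: le_trans (ltW (fN n nN)); rewrite /tau_terms !absM.
  by rewrite ler_wpM2l// ler_abs_qpow.
exists w; split=> [n|].
  have [nN|nN] := ltnP `|n| N; first by have := gwy n; rewrite /g nN.
  exact: le_trans (tail _ nN) (ltW (half_lt ay)).
have gF := tau_supp_calF gN; rewrite -{1}gw -evB//.
apply: ev_gauss; first exact: calFB.
move=> n; rewrite /g; case: ltnP => nN; last by rewrite sub0r mulNr absN tail.
by rewrite subrr mul0r abs0 divr_ge0.
Qed.

Lemma half_iter_lt (B eps : R) : 0 <= B -> 0 < eps ->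
  exists N, forall k, (N <= k)%N -> B / 2 ^+ k < eps.
Proof.
move=> B0 eps0; have be0 : 0 <= B / eps by rewrite divr_ge0 // ltW.
exists (Num.Def.archi_bound (B / eps)) => k kN.
rewrite ltr_pdivrMr ?exprn_gt0// mulrC -ltr_pdivrMr//.
apply: lt_le_trans (archi_boundP be0) _.
apply: le_trans (_ : k%:R <= _); first by rewrite ler_nat.
by rewrite -natrX ler_nat ltnW// ltn_expl.
Qed.

Lemma tau_solve f n0 y : cF f -> f n0 != 0 ->
  exists2 w, ev f w = y & gauss_le f w (a y).
Proof.
move=> fF fn0; have [y0|y0] := eqVneq y 0.
  exists 0; first by rewrite ev0r.
  by move=> n; rewrite qpow_0 mulr0 abs0.
have /choice[s sP] := fun y => tau_approx_solve y fF fn0.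
(* [Y k] is the error left after [k] corrections, and [W k] below is the sum of these
   corrections. *)
pose Y k := iter k (fun y => y - ev f (s y)) y.
pose W k := \sum_(i < k) s (Y i).
have YS k : Y k.+1 = Y k - ev f (s (Y k)) by [].
have Yle k : a (Y k) <= a y / 2 ^+ k.
  elim: k => [|k IH]; first by rewrite expr0 divr1.
  rewrite YS; apply: le_trans (sP (Y k)).2 _.
  by rewrite exprSr invfM mulrA ler_wpM2r.
have YleY k : a (Y k) <= a y.
  apply: le_trans (Yle k) _.
  by rewrite ler_pdivrMr ?exprn_gt0// ler_peMr// exprn_ege1// ler1n.
have WS k : W k.+1 = W k + s (Y k) by rewrite /W big_ord_recr.
have evW k : ev f (W k) = y - Y k.
  elim: k => [|k IH]; first by rewrite /W big_ord0 ev0r// subrr.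
  by rewrite WS evDr// IH YS; ring.
have gW k : gauss_le f (W k) (a y).
  elim: k => [|k IH]; first by move=> n; rewrite /W big_ord0 qpow_0 mulr0 abs0.
  by rewrite WS; apply: gauss_leDr => //; exact: gauss_le_trans (sP _).1.
have [w Ww] : exists w, tends W w.
  apply: tends_cauchy => // eps eps0.
  have [d d0 dP] := qpow_small (- n0) eps0.
  have dn0 : 0 < d * a (f n0) by rewrite mulr_gt0 ?abs_gt0.
  have [N NP] := half_iter_lt (abs_ge0 y) dn0.
  exists N => k Nk; rewrite WS addrAC subrr add0r.
  apply: le_trans (gauss_le_arg fn0 (sP (Y k)).1) (ltW (dP _ _)).
  by rewrite absf ltr_pdivrMr ?abs_gt0// (le_lt_trans (Yle k)) ?NP.
exists w.
  apply: (@tends_unique _ _ _ (fun k => ev f (W k))); first exact: ev_tends.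
  move=> eps eps0; have [N NP] := half_iter_lt (abs_ge0 y) eps0.
  exists N => k Nk; rewrite evW addrAC subrr add0r absN.
  by rewrite (le_lt_trans (Yle k)) ?NP.
(* The Gauss bound is checked term by term, so the approximation [W N] may depend on [n]. *)
move=> n; have ay : 0 < a y by rewrite abs_gt0.
have [d d0 dP] := mulr_small (f n) ay; have [d' d'0 d'P] := qpow_small n d0.
have [N NP] := Ww _ d'0; have := NP _ (leqnn N); rewrite absBC => /d'P/dP/ltW h.
by rewrite -(subrK (W N) w) qpowD mulrDr absD_le// gW.
Qed.

(** A nonzero difference of series would take the value 1 by [tau_solve]. *)
Lemma tau_eval_inj f g : cF f -> cF g -> (forall z, ev f z = ev g z) -> f = g.
Proof.
move=> fF gF fg; apply/funext => n; apply/eqP; rewrite -subr_eq0; apply/negP => /negP h.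
have [w] := @tau_solve (fun n => f n - g n) n 1 (calFB fF gF) h.
by rewrite evB// fg subrr => /eqP; rewrite eq_sym oner_eq0.
Qed.

(* The Gauss norm is the sup norm: solve f w = f_n x^(q^n). *)
Lemma gauss_le_sup f x B : cF f -> 0 <= B ->
  (forall w, a w <= a x -> a (ev f w) <= B) -> gauss_le f x B.
Proof.
move=> fF B0 fB n; have [->|fn] := eqVneq (f n) 0; first by rewrite mul0r abs0.
have [w wE gw] := tau_solve (f n * qp n x) fF fn; rewrite -wE; apply: fB.
by have := gauss_le_arg fn gw; rewrite [f n * _]mulrC mulfK// qpowK.
Qed.

(** * Series with trivial kernel *)

Section Monomial.
Variable f : tau_series a.
Hypothesis fF : cF f.

Let M n z := a (f n * qp n z).

Lemma abs_le_scale x y : x != 0 -> a x <= a y -> exists2 t, 1 <= a t & y = x * t.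
Proof.
move=> x0 xy; exists (y / x); last by rewrite mulrC divfK.
by rewrite absf ler_pdivlMr ?abs_gt0// mul1r.
Qed.

(** Scaling the argument by [t] with [|t| >= 1] multiplies the [k]-th term by [|t| ^ (q ^ k)], so
    later terms gain. Comparisons persist towards smaller radii here, towards larger ones in
    [term_le_up]. *)
Lemma term_le_mono n m x y : x != 0 -> a x <= a y -> n < m ->
  M m y <= M n y -> M m x <= M n x.
Proof.
move=> x0 xy nm; have [t t1 ->] := abs_le_scale x0 xy.
rewrite /M !qpowM !mulrA !(absM _ (qp _ t)) => h.
have tn : 0 < a (qp n t) by rewrite abs_gt0 qpow_eq0 -abs_gt0 (lt_le_trans ltr01).
rewrite -(ler_pM2r tn); apply: le_trans h.
by rewrite ler_wpM2l// abs_qpow_le_index// ltW.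
Qed.

Lemma term_le_up n m x y : x != 0 -> a x <= a y -> n < m ->
  M n x <= M m x -> M n y <= M m y.
Proof.
move=> x0 xy nm; have [t t1 ->] := abs_le_scale x0 xy.
rewrite /M !qpowM !mulrA !(absM _ (qp _ t)) => h.
by rewrite ler_pM// abs_qpow_le_index// ltW.
Qed.

(** With [y = x ^ (q ^ n)] it suffices that [y ^ (q ^ (m - n) - 1) = f n / f m], which is solvable
    in an algebraically closed field. *)
Lemma tie_exists n m : n < m -> f n != 0 -> f m != 0 ->
  exists2 x, x != 0 & M m x = M n x.
Proof.
move=> nm fn fm; have [k mE] : exists k : nat, m = k.+1%:Z + n.
  by exists (absz (m - n)).-1; lia.
have qk : (1 < q ^ k.+1)%N by rewrite (leq_trans q_gt1)// -[leqLHS]expn1 leq_exp2l.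
have [|y yE] := @root_exists (q ^ k.+1).-1 (f n / f m); first by lia.
have y0 : y != 0.
  apply/eqP => y0; move/eqP: yE; rewrite y0 expr0n.
  have -> : ((q ^ k.+1).-1 == 0)%N = false by lia.
  by rewrite eq_sym mulf_eq0 invr_eq0 (negPf fn) (negPf fm).
exists (qp (- n) y); first by rewrite qpow_eq0.
rewrite /M mE -qpowA qpowVK /= -(prednK (ltnW qk)) exprS yE.
by congr (a _); rewrite -mE; field.
Qed.

(* As the radius grows from 0, the first radius at which a later term catches up with
   the n-th one. *)
Lemma first_tie n : f n != 0 -> (exists2 m, n < m & f m != 0) ->
  exists2 x, x != 0 & (exists2 m, n < m & M m x = M n x) /\
    (forall m, n < m -> M m x <= M n x).
Proof.
move=> fn [j nj fj].
have /choice[X XP] : forall m, exists x, n < m -> f m != 0 -> x != 0 /\ M m x = M n x.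
  move=> m; have [[nm fm]|h] := pselect (n < m /\ f m != 0).
    by have [x x0 xE] := tie_exists nm fn fm; exists x.
  by exists 0 => nm fm; case: h.
have [Xj0 Xj] := XP _ nj fj.
have Mn0 x : x != 0 -> 0 < M n x.
  by move=> x0; rewrite /M abs_gt0 mulf_neq0 ?qpow_eq0.
have [N fN] := (calFP f).1 fF (X j) _ (Mn0 _ Xj0).
(* Only terms that have caught up with the [n]-th at [X j] can tie at a smaller radius, and this
   finite list contains all of their indices. *)
pose s := [seq m <- [seq n + k%:Z | k <- iota 0 (N + `|n|).+1] |
            (n < m) && (f m != 0)].
have ms m : n < m -> f m != 0 -> M n (X j) <= M m (X j) -> m \in s.
  move=> nm fm h; rewrite mem_filter nm fm; apply/mapP.
  have mN : (`|m| < N)%N.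
    by rewrite ltnNge; apply/negP => /fN; rewrite ltNge => /negP; apply.
  exists (absz (m - n)); last by lia.
  by rewrite mem_iota; lia.
have js : j \in s by apply: ms => //; rewrite Xj.
have [|k ks kmin] := seq_argmin (fun m => a (X m)) (s := s); first by case: (s) js.
move: (ks); rewrite mem_filter => /andP[/andP[nk fk] _].
have [Xk0 Xk] := XP _ nk fk; exists (X k) => //; split; first by exists k.
move=> m nm; rewrite leNgt; apply/negP => lt_nm.
have fm : f m != 0.
  by apply: contraTneq lt_nm => fm; rewrite /M fm mul0r abs0 -leNgt.
have [Xm0 Xm] := XP _ nm fm.
suff /kmin km : m \in s.
  have : M m (X k) <= M n (X k) by apply: (term_le_mono Xk0 km nm); rewrite Xm.
  by rewrite leNgt lt_nm.
apply: ms => //; rewrite leNgt; apply/negP => /ltW.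
by move=> /(term_le_mono Xk0 (kmin _ js) nm); rewrite leNgt lt_nm.
Qed.

(** If the [n]-th term is not maximal at its first tie [x], the maximal index [i] there is below
    [n], and the first tie [y] of [i] works: later terms are bounded by construction, earlier ones
    because [|x| <= |y|] and [i] was already maximal at [x]. *)
Lemma max_tie n m : n != m -> f n != 0 -> f m != 0 ->
  exists2 x, x != 0 & exists i j, [/\ i != j, f i != 0, M i x = M j x &
    forall k, M k x <= M i x].
Proof.
wlog nm : n m / n < m => [hw nm fn fm|_ fn fm].
  case/orP: (lt_total nm) => lt; first exact: (hw n m).
  by apply: (hw m n) => //; rewrite eq_sym.
have [x x0 [[j nj jE] xmax]] : exists2 x, x != 0 &
    (exists2 m, n < m & M m x = M n x) /\ (forall m, n < m -> M m x <= M n x).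
  by apply: first_tie => //; exists m.
have [i imax] := gauss_argmax x fF.
have [ni|in_] := leP (M i x) (M n x).
  exists x => //; exists n, j; split=> // [|k]; first by rewrite lt_eqF.
  exact: le_trans (imax k) ni.
have lt_in : i < n.
  rewrite ltNge le_eqVlt; apply/negP => /orP[/eqP ni|/xmax].
    by rewrite ni ltxx in in_.
  by rewrite leNgt in_.
have fi : f i != 0.
  by apply: contraTneq in_ => fi; rewrite /M fi mul0r abs0 -leNgt.
have [y y0 [[l il lE] ymax]] : exists2 x, x != 0 &
    (exists2 m, i < m & M m x = M i x) /\ (forall m, i < m -> M m x <= M i x).
  by apply: first_tie => //; exists n.
have My : 0 < M i y by rewrite /M abs_gt0 mulf_neq0 ?qpow_eq0.
have fl : f l != 0.
  by apply: contraTneq My => fl; rewrite -lE /M fl mul0r abs0 ltxx.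
exists y => //; exists i, l; split=> // [|k]; first by rewrite lt_eqF.
have [ik|ki|->//] := ltgtP i k; first exact: ymax.
have xy : a x <= a y.
  rewrite leNgt; apply/negP => yx.
  have := imax l; rewrite -/(M _ _) -/(M _ _) leNgt => /negP; apply.
  have [t t1 xE] : exists2 t, 1 < a t & x = y * t.
    exists (x / y); last by rewrite mulrC divfK.
    by rewrite absf ltr_pdivlMr ?abs_gt0// mul1r.
  rewrite xE /M !qpowM !mulrA !(absM _ (qp _ t)) -!/(M _ _) lE.
  by rewrite ltr_pM2l// abs_qpow_lt_index.
exact: term_le_up x0 xy ki (imax k).
Qed.

Lemma zsum_eq0_tie u n : vanish u -> zsum u = 0 -> u n != 0 ->
  exists i j, [/\ i != j, u i != 0 & a (u i) = a (u j)].
Proof.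
move=> u0 zu un; have [i imax] := vanish_argmax u0.
have ui : u i != 0 by rewrite -abs_gt0 (lt_le_trans _ (imax n))// abs_gt0.
have [dom|/existsNP[j /not_implyP[ji /negP]]] :=
    pselect (forall j, j != i -> a (u j) < a (u i)).
  have := zsum_dominant u0 dom; rewrite zu abs0 => /eqP.
  by rewrite eq_sym abs_eq0 (negPf ui).
rewrite -leNgt => uij; exists i, j; split=> //; first by rewrite eq_sym.
by apply/eqP; rewrite eq_le uij imax.
Qed.

(* The part D of f that is maximal at the tie point x has a nonzero root z, of the
   same absolute value as x. *)
Lemma injective_monomial : (forall z, ev f z = 0 -> z = 0) ->
  forall n m, f n != 0 -> f m != 0 -> n = m.
Proof.
move=> f_inj n m fn fm; apply/eqP; apply: contraT => nm.
(* With trivial kernel, [z] is the only preimage of [ev f z], hence the controlled one given by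
   [tau_solve]. *)
have gauss_ev z : gauss_le f z (a (ev f z)).
  have [w wz gw] := tau_solve (ev f z) fF fn.
  suff -> : z = w by rewrite wz.
  by apply/eqP; rewrite -subr_eq0; apply/eqP/f_inj; rewrite evBr// wz subrr.
have [x x0 [i [j [ij fi Mij Mmax]]]] := max_tie nm fn fm.
have Mi0 : 0 < M i x by rewrite /M abs_gt0 mulf_neq0 ?qpow_eq0.
pose D : tau_series a := fun n => if M n x == M i x then f n else 0.
have [N fN] := (calFP f).1 fF x _ Mi0.
have DN : tau_supp D N.
  have D0 k : (N <= `|k|)%N -> D k = 0.
    by move=> /fN; rewrite /D -/(M k x) => /lt_eqF ->.
  by move=> k Nk; split; apply: D0; lia.
have fj : f j != 0.
  by apply: contraTneq Mi0 => fj; rewrite Mij /M fj mul0r abs0 ltxx.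
have Di : D i != 0 by rewrite /D eqxx.
have Dj : D j != 0 by rewrite /D Mij eqxx.
have [z z0 Dz] := tau_supp_nontrivial_root DN ij Di Dj.
have DF := tau_supp_calF DN.
(* Two terms of [D] tie both at [x] and at [z], so two different powers of [|z / x|] agree, which
   forces [|z / x| = 1]. *)
have zx : a z = a x.
  have Diz : tau_terms q D z i != 0 by rewrite mulf_neq0 ?qpow_eq0.
  have [k [l [kl Dk Dkl]]] := zsum_eq0_tie ((calFP D).1 DF z) Dz Diz.
  have Dl : tau_terms q D z l != 0 by rewrite -abs_gt0 -Dkl abs_gt0.
  have fD o : tau_terms q D z o != 0 -> f o = D o /\ M o x = M i x.
    by rewrite /tau_terms /D; case: (eqVneq (M o x)) => [//|_]; rewrite mul0r eqxx.
  have [[fk Mk] [fl Ml]] := (fD _ Dk, fD _ Dl).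
  have {}Dkl : M k z = M l z by rewrite /M fk fl.
  have t0 : z / x != 0 by rewrite mulf_neq0 ?invr_eq0.
  have Mt o : M o z = M o x * a (qp o (z / x)).
    by rewrite /M -absM -mulrA -qpowM [x * _]mulrC divfK.
  move: Dkl; rewrite !Mt Mk Ml => /(mulfI (lt0r_neq0 Mi0)).
  move=> /(abs_qpow_index_eq kl t0); rewrite absf => /divr1_eq//.
have fD_lt : a (ev (fun n => f n - D n) z) < M i x.
  have [k kmax] := gauss_argmax z (calFB fF DF).
  apply: le_lt_trans (ev_gauss (calFB fF DF) kmax) _.
  rewrite absM (abs_qpow_eq k zx) -absM /D; case: eqP => [_|/eqP ne].
    by rewrite subrr mul0r abs0.
  by rewrite subr0 lt_def eq_sym ne Mmax.
have := gauss_ev z i; rewrite absM (abs_qpow_eq i zx) -absM -/(M i x) leNgt.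
by move: fD_lt; rewrite evB// Dz subr0 => ->.
Qed.

End Monomial.

(** * Right division *)

Lemma vanish_if (P : pred int) u : vanish u -> vanish (fun n => if P n then u n else 0).
Proof. by apply: vanish_le => n; case: ifP => // _; rewrite abs0. Qed.

(* Right division by y - d (y / d)^q; the quotient has coefficients
   d^(-q^n) \sum_(m <= n) f_m d^(q^m). *)
Lemma tau_div_root f (d : K) : cF f -> d != 0 -> ev f d = 0 ->
  exists2 g, cF g & forall y, ev f y = ev g (y - d * (y / d) ^+ q).
Proof.
move=> fF d0 fd; pose t n := f n * qp n d.
have t0 : vanish t by exact: (calFP f).1 fF d.
pose s n := zsum (fun m => if m <= n then t m else 0).
have sE n : s n - s (n - 1) = t n.
  rewrite /s -zsumB; [|exact: vanish_if..].
  rewrite (@zsum1 _ n) => [|m mn].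
    by rewrite lexx; case: ifP => [|_]; [lia | rewrite subr0].
  case: (leP m n) => mn1; case: leP => mn2; rewrite ?subrr//; exfalso; lia.
have s_lo n B : (forall m, m <= n -> a (t m) <= B) -> a (s n) <= B.
  move=> tB; apply: zsum_abs_le => [|m]; first exact: vanish_if.
  by case: ifP => [/tB//|_]; rewrite abs0 (le_trans _ (tB _ (lexx n))).
(* All terms add up to [f d = 0], so [s n] is also minus the tail beyond [n]; this form is the
   useful one for large [n]. *)
have s_hi n B : (forall m, n < m -> a (t m) <= B) -> a (s n) <= B.
  move=> tB; have -> : s n = - zsum (fun m => if n < m then t m else 0).
    apply/eqP; rewrite -subr_eq0 opprK /s -zsumD; [|exact: (vanish_if (fun m => _))..].
    rewrite -[X in _ == X]fd; apply/eqP; congr zsum; apply/funext => m.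
    by case: leP; rewrite ?addr0 ?add0r.
  rewrite absN; apply: zsum_abs_le => [|m]; first exact: (vanish_if (fun m => _)).
  case: ifP => [/tB//|_]; rewrite abs0 (le_trans _ (tB (n + 1) _))//; lia.
have s_van x : vanish (fun n => s n * qp n x).
  wlog x1 : x / 1 <= a x => [hw|].
    have [/hw//|/ltW x1] := leP 1 (a x).
    apply: vanish_le (hw 1 _) => [n|]; last by rewrite abs1.
    by rewrite !absM ler_wpM2l// ler_abs_qpow abs1.
  have ax : 0 < a x by exact: lt_le_trans x1.
  have aqx n : 0 < a (qp n x) by rewrite abs_gt0 qpow_eq0 -abs_gt0.
  move=> eps eps0; have e2 : 0 < eps / 2 by rewrite divr_gt0.
  have e3 : 0 < eps / 2 / a x by rewrite divr_gt0.
  (* [N] serves negative [n], where [|x ^ (q ^ n)| <= |x|]; [M] serves the others, where the power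
     of [x] is absorbed into the terms of [f] at [d * x]. *)
  have [N tN] := t0 _ e3; have [M tM] := (calFP f).1 fF (d * x) _ e2.
  exists (N + M)%N => n nNM; apply: le_lt_trans (half_lt eps0).
  rewrite absM -ler_pdivlMr//; have [n0|n0] := leP 0 n.
    apply: s_hi => m nm; rewrite ler_pdivlMr//.
    have mM : (M <= `|m|)%N by lia.
    have := ltW (tM m mM); rewrite /tau_terms qpowM mulrA absM; apply: le_trans.
    by rewrite ler_wpM2l// abs_qpow_le_index// ltW.
  apply: s_lo => m mn; apply: le_trans (ltW (tN m _)) _; first by lia.
  rewrite ler_wpM2l ?(ltW e2)// lef_pV2 ?posrE//.
  by rewrite -[in leRHS](qpow0 x) abs_qpow_le_index// ltW.
pose g : tau_series a := fun n => s n / qp n d.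
have gE z n : tau_terms q g z n = s n * qp n (z / d).
  by rewrite /tau_terms /g qpowM qpowV mulrAC mulrA.
have gF : cF g.
  apply/calFP => z; have := s_van (z / d); apply: vanish_le => n; by rewrite gE.
exists g => // y; rewrite evBr// /tau_eval.
have -> : tau_terms q g (d * (y / d) ^+ q) = fun n => s n * qp (n + 1) (y / d).
  apply/funext => n; rewrite gE mulrAC divff// mul1r.
  by rewrite qpowX -qpow_succ.
have -> : tau_terms q g y = fun n => s n * qp n (y / d) by apply/funext => n; exact: gE.
have sv : vanish (fun n => s n * qp (n + 1) (y / d)).
  by apply: vanish_le (s_van ((y / d) ^+ q)) => n; rewrite qpowX -qpow_succ.
rewrite -(zsum_shift (-1) sv) -zsumB//; last exact: (vanish_shift (-1) sv).
congr zsum; apply/funext => n.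
by rewrite subrK -mulrBl sE /t -mulrA -qpowM [d * _]mulrC divfK.
Qed.

(** * Divisibility on the right and its passage to limits *)

(** The factorisation is stated on values, which determine the series by [tau_eval_inj]. *)
Definition factors_through f (G : set K) : Prop := forall g, cF g ->
  (forall z, G z -> ev g z = 0) ->
  exists2 u, cF u & forall z, ev u (ev f z) = ev g z.

(** The quotients [u k] are equicontinuous at 0: a small [y] is [f_ k w] with [w] small uniformly in
    [k], so [u k y = g w] is small. Hence [u k (f z)] tends to [g z] uniformly on discs, and
    controlled surjectivity of [f] makes [u] a Cauchy sequence for the Gauss norms. *)
Lemma factors_through_lim (f_ : nat -> tau_series a) f n0 (G : set K) :
  (forall k, cF (f_ k)) -> cF f -> gauss_cvg f_ f -> f n0 != 0 ->
  (forall k, factors_through (f_ k) G) -> factors_through f G.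
Proof.
move=> f_F fF ff fn0 fG g gF gG.
have /choice[u uP] : forall k, exists u, cF u /\ forall z, ev u (ev (f_ k) z) = ev g z.
  by move=> k; have [u uF uE] := fG k g gF gG; exists u.
have uF k : cF (u k) by have [] := uP k.
have uE k z : ev (u k) (ev (f_ k) z) = ev g z by have [] := uP k.
have equi (eps : R) : 0 < eps -> exists (eta : R) (N : nat), 0 < eta /\
    forall k y, (N <= k)%N -> a y <= eta -> a (ev (u k) y) <= eps.
  move=> eps0; have [d d0 dP] := ev_small gF eps0.
  have [e e0 eP] := qpow_small (- n0) d0.
  have fn0_gt0 : 0 < a (f n0) by rewrite abs_gt0.
  have [N NP] := gauss_cvg_coef n0 ff fn0_gt0.
  exists (e / 2 * a (f n0)), N; split; first by rewrite mulr_gt0 ?divr_gt0.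
  move=> k y Nk ye.
  have fk : a (f_ k n0) = a (f n0) by apply: abs_close; rewrite absBC NP.
  have fk0 : f_ k n0 != 0 by rewrite -abs_gt0 fk.
  have [w wy gw] := tau_solve y (f_F k) fk0; rewrite -wy uE.
  apply: ev_gauss => //; apply: dP.
  apply: le_lt_trans (gauss_le_arg fk0 gw) (eP _ _).
  rewrite absf fk; apply: le_lt_trans (half_lt e0).
  by rewrite ler_pdivrMr.
have near_g (eps : R) x : 0 < eps -> exists N, forall k z, (N <= k)%N -> a z <= a x ->
    a (ev (u k) (ev f z) - ev g z) <= eps.
  move=> /equi[eta [N [eta0 NP]]]; have [M MP] := ff x _ eta0.
  exists (maxn N M) => k z; rewrite geq_max => /andP[Nk Mk] zx.
  rewrite -(uE k) -evBr//; apply: NP => //; rewrite -evB//.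
  by apply: ev_gauss; [exact: calFB | exact: gauss_le_sub (MP _ Mk)].
have [h hF uh] : exists2 h, cF h & gauss_cvg u h.
  apply: gauss_cauchy => // x eps eps0.
  have [N NP] := near_g _ (qp (- n0) (x / f n0)) eps0; exists N => k Nk.
  apply: gauss_le_sup => [||y yx]; [exact: calFB | exact: ltW | ].
  rewrite evB//; have [w wy gw] := tau_solve y fF fn0.
  have wx : a w <= a (qp (- n0) (x / f n0)).
    apply: le_trans (gauss_le_arg fn0 gw) _.
    by rewrite ler_abs_qpow !absf ler_wpM2r// invr_ge0.
  rewrite -wy -(subrKA (ev g w)) absD_le//.
    by rewrite NP// (leq_trans Nk).
  by rewrite absBC NP.
exists h => // z; apply: (@tends_unique _ _ _ (fun k => ev (u k) (ev f z))).
  exact: gauss_cvg_ev.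
move=> eps eps0; have [|N NP] := near_g (eps / 2) z; first by rewrite divr_gt0.
by exists N => k Nk; apply: le_lt_trans (half_lt eps0); exact: NP.
Qed.

Lemma tau_rmul f (c : K) (k : int) : cF f ->
  exists2 g, cF g & forall z, ev g z = ev f (c * qp k z).
Proof.
move=> /calFP fF; pose g : tau_series a := fun n => f (n - k) * qp (n - k) c.
have gE z : tau_terms q g z = fun n => tau_terms q f (c * qp k z) (n + - k).
  by apply/funext => n; rewrite /tau_terms /g qpowM qpowA subrK mulrA.
exists g; first by apply/calFP => z; rewrite gE; exact: vanish_shift.
by move=> z; rewrite /tau_eval gE (zsum_shift _ (fF _)).
Qed.

(** * Killing a point *)

Variables (Fq : finFieldType) (iota : {rmorphism Fq -> K}).
Hypothesis card_Fq : #|Fq| = q.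

Let qm1_gt0 : (0 < q.-1)%N. Proof. by rewrite -subn1 subn_gt0. Qed.

Lemma iota_frob c : iota c ^+ q = iota c.
Proof. by rewrite -rmorphXn -card_Fq expf_card. Qed.

Lemma evZiota f c z : cF f -> ev f (iota c * z) = iota c * ev f z.
Proof. by move=> fF; rewrite evZr// iota_frob. Qed.

(** For [d] nonzero this is [X ^ q - X], the product of all [X - c] over the finite field, evaluated
    at [y / d] and rescaled by [d ^ q]. *)
Lemma prod_subZ (y d : K) : \prod_c (y - iota c * d) = y ^+ q - d ^+ q.-1 * y.
Proof.
have [->|d0] := eqVneq d 0.
  rewrite (eq_bigr (fun=> y)); last by move=> c _; rewrite mulr0 subr0.
  by rewrite prodr_const card_Fq expr0n -leqn0 leqNgt qm1_gt0 mul0r subr0.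
have -> : y ^+ q - d ^+ q.-1 * y = d ^+ q * ((y / d) ^+ q - y / d).
  rewrite expr_div_n mulrBr [d ^+ q * _]mulrC divfK ?expf_neq0//; congr (_ - _).
  by rewrite -{2}(prednK q_gt0) exprSr -mulrA [d * _]mulrC divfK.
have := congr1 (fun p => (map_poly iota p).[y / d]) (finField_genPoly Fq).
rewrite /= rmorphB /= map_polyXn map_polyX !hornerE card_Fq => ->.
rewrite rmorph_prod horner_prod -card_Fq -(prodr_const _ d) -big_split /=.
apply: eq_bigr => c _; rewrite rmorphB /= map_polyX map_polyC !hornerE.
by rewrite mulrBr [d * (_ / _)]mulrC divfK// [d * _]mulrC.
Qed.

(* tau^-1 o (tau - d^(q-1)) o f with d = f x: kills x and keeps the
   normalisation at the top coefficient. *)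
Definition kill_down f x : tau_series a :=
  fun n => f n - tau_lmul (qp (-1) (ev f x ^+ q.-1)) (-1) f n.

(* (1 - d^(1-q) tau) o f with d = f x; this is f when f x = 0, since 0 / 0 = 0. *)
Definition kill_up f x : tau_series a :=
  fun n => f n - tau_lmul (ev f x / ev f x ^+ q) 1 f n.

Lemma calF_kill_down f x : cF f -> cF (kill_down f x).
Proof. by move=> fF; apply: calFB => //; exact: calF_lmul. Qed.

Lemma calF_kill_up f x : cF f -> cF (kill_up f x).
Proof. by move=> fF; apply: calFB => //; exact: calF_lmul. Qed.

Lemma ev_kill_downX f x z : cF f ->
  ev (kill_down f x) z ^+ q = ev f z ^+ q - ev f x ^+ q.-1 * ev f z.
Proof.
move=> fF; rewrite evB//; last exact: calF_lmul.
rewrite ev_lmul// -qpowM -!qpow1 qpowB qpowA addrN qpow0; congr (_ - _).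
Qed.

Lemma ev_kill_down_prod f x z : cF f ->
  ev (kill_down f x) z ^+ q = \prod_c ev f (z - iota c * x).
Proof.
move=> fF; rewrite ev_kill_downX// -prod_subZ; apply: eq_bigr => c _.
by rewrite evBr// evZiota.
Qed.

Lemma ev_kill_up f x z : cF f ->
  ev (kill_up f x) z = ev f z - ev f x * (ev f z / ev f x) ^+ q.
Proof.
move=> fF; rewrite evB//; last exact: calF_lmul.
by rewrite ev_lmul// qpow1 expr_div_n mulrAC mulrA.
Qed.

(** Up to the nonzero factor [- d ^ (q - 1)] the value is the product of all [f (z - c x)]. *)
Lemma kill_up_eq0 f x z : cF f -> ev f x != 0 ->
  ev (kill_up f x) z = 0 <-> exists c, ev f (z - iota c * x) = 0.
Proof.
move=> fF fx0; set d := ev f x in fx0 *.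
have key : - (d ^+ q.-1 * ev (kill_up f x) z) = \prod_c ev f (z - iota c * x).
  transitivity (ev f z ^+ q - d ^+ q.-1 * ev f z).
    rewrite ev_kill_up// -/d mulrBr opprB mulrA -exprSr prednK// expr_div_n.
    by rewrite [d ^+ q * _]mulrC divfK ?expf_neq0.
  by rewrite -prod_subZ; apply: eq_bigr => c _; rewrite evBr// evZiota.
split=> [z0|[c cz]].
  have : \prod_c ev f (z - iota c * x) == 0 by rewrite -key z0 mulr0 oppr0.
  by move=> /prodf_eq0[c _ /eqP]; exists c.
have : d ^+ q.-1 * ev (kill_up f x) z == 0.
  by rewrite -oppr_eq0 key; apply/prodf_eq0; exists c => //; apply/eqP.
by rewrite mulf_eq0 expf_eq0 (negPf fx0) andbF => /eqP.
Qed.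

(** If [g = u o f] vanishes at [x], then [u] vanishes at [f x], and [tau_div_root] splits off
    exactly the factor added by [kill_up]. *)
Lemma factors_kill_up f x (G : set K) : cF f -> G x ->
  factors_through f G -> factors_through (kill_up f x) G.
Proof.
move=> fF Gx fG g gF gG; have [u uF uE] := fG g gF gG.
have [fx|fx] := eqVneq (ev f x) 0.
  by exists u => // z; rewrite ev_kill_up// fx mul0r subr0.
have [|v vF vE] := tau_div_root uF fx; first by rewrite uE gG.
by exists v => // z; rewrite ev_kill_up// -vE.
Qed.

(** When [f x] is nonzero, [kill_down] differs from [kill_up] by an invertible monomial on the left,
    which [tau_rmul] absorbs into the quotient. *)
Lemma factors_kill_down f x (G : set K) : cF f -> G x ->
  factors_through f G -> factors_through (kill_down f x) G.
Proof.
move=> fF Gx fG g gF gG; have [u uF uE] := fG g gF gG.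
have [fx|fx] := eqVneq (ev f x) 0.
  exists u => // z; rewrite evB//; last exact: calF_lmul.
  by rewrite ev_lmul// fx expr0n -leqn0 leqNgt qm1_gt0 qpow_0 mul0r subr0.
have [|v vF vE] := tau_div_root uF fx; first by rewrite uE gG.
have [w wF wE] := tau_rmul (- (ev f x ^+ q.-1)^-1) 1 vF.
exists w => // z; rewrite wE qpow1 ev_kill_downX// -uE vE; congr tau_eval.
rewrite expr_div_n; set d := ev f x in fx *.
have dq : d ^+ q = d * d ^+ q.-1 by rewrite -exprS prednK.
have d1 : d ^+ q.-1 != 0 by rewrite expf_neq0.
rewrite dq; move: (d ^+ q.-1) d1 (ev f z ^+ q) (ev f z) => D D0 Y y.
by field; rewrite ?fx ?D0.
Qed.

Lemma gauss_kill_down f x z : cF f -> a x <= a z -> gauss_le f z (a z) ->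
  gauss_le (kill_down f x) z (a z).
Proof.
move=> fF xz fz; apply: gauss_leB => //.
apply: gauss_le_trans (gauss_le_lmul (qp (-1) (ev f x ^+ q.-1)) (-1) fz).
rewrite -qpowM -(ler_abs_qpow 1) qpowA addrN qpow0 qpow1 absX absM absX.
rewrite -[in leRHS](prednK q_gt0) exprSr ler_wpM2r//.
by rewrite lerXn2r ?nnegrE// (ev_gauss fF)//; exact: gauss_le_sub fz.
Qed.

Lemma tau_mono_supp (c : K) : tau_supp (tau_mono c 0) 1.
Proof. by move=> [|k]. Qed.

Lemma ev_mono (c : K) k z : ev (tau_mono c k) z = c * qp k z.
Proof.
rewrite /tau_eval (@zsum1 _ k) /tau_terms /tau_mono ?eqxx//.
by move=> n /negPf ->; rewrite mul0r.
Qed.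

Lemma factors_mono1 (G : set K) : factors_through (tau_mono 1 0) G.
Proof. by move=> g gF _; exists g => // z; rewrite ev_mono qpow0 mul1r. Qed.

Lemma subspaceN (H : set K) x : is_subspace iota H -> H x -> H (- x).
Proof. by move=> [_ _ HZ] /(HZ (-1)); rewrite rmorphN1 mulN1r. Qed.

Lemma subspaceB (H : set K) x y : is_subspace iota H -> H x -> H y -> H (x - y).
Proof. by move=> HH Hx Hy; have [_ HD _] := HH; apply: HD => //; exact: subspaceN. Qed.

Lemma prod_const_Fq (d : R) : \prod_(c : Fq) d = d ^+ q.
Proof. by rewrite prodr_const card_Fq. Qed.

(** * Compact kernels *)

Section Chain.
Variable x : nat -> K.

Fixpoint chain (m : nat) : tau_series a :=
  if m is k.+1 then kill_down (chain k) (x k) else tau_mono 1 0.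

Lemma chainS k : chain k.+1 = kill_down (chain k) (x k). Proof. by []. Qed.

Lemma chain_calF (m : nat) : cF (chain m).
Proof.
elim: m => [|m IH]; first exact: tau_supp_calF (tau_mono_supp 1).
exact: calF_kill_down.
Qed.

Lemma chain_gauss (m : nat) z : (forall i, a (x i) <= a z) -> gauss_le (chain m) z (a z).
Proof.
move=> xz; elim: m => [|m IH] /=; last by apply: gauss_kill_down => //; exact: chain_calF.
move=> n; rewrite /tau_mono; case: eqP => [->|_]; last by rewrite mul0r abs0.
by rewrite qpow0 mul1r.
Qed.

(** Corrections are shifted by tau^-1, so no positive power of tau ever appears and the coefficient
    at 0 is never altered. *)
Lemma chain_coef_gt0 (m : nat) n : 0 < n -> chain m n = 0.
Proof.
elim: m n => [|m IH] n n0 /=; first by rewrite /tau_mono gt_eqF.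
by rewrite /kill_down /tau_lmul opprK !IH ?qpow_0 ?mulr0 ?subr0//; lia.
Qed.

Lemma chain_coef0 (m : nat) : chain m 0 = 1.
Proof.
elim: m => [|m IH] //=.
by rewrite /kill_down /tau_lmul opprK add0r IH chain_coef_gt0// qpow_0 mulr0 subr0.
Qed.

Lemma chain_factors (m : nat) (G : set K) : (forall i, G (x i)) -> factors_through (chain m) G.
Proof.
move=> xG; elim: m => [|m IH]; first exact: factors_mono1.
by apply: factors_kill_down => //; exact: chain_calF.
Qed.

Lemma chain_abs_succ (m : nat) z :
  a (ev (chain m.+1) z) ^+ q = \prod_c a (ev (chain m) (z - iota c * x m)).
Proof.
rewrite -absX /= ev_kill_down_prod; last exact: chain_calF.
by rewrite (big_morph (nabs a) (@absM _ _ a) (abs1 a)).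
Qed.

Variable H : set K.
Hypothesis H_sub : is_subspace iota H.
Hypothesis xH : forall i, H (x i).

Lemma H_scale_x c i : H (iota c * x i). Proof. by have [_ _] := H_sub; apply. Qed.

(** [|f_m z| ^ (q ^ m)] is a product of distances from [z] to points of [H]. The bound is uniform in
    [m], so the limit cannot vanish outside [H]. *)
Lemma chain_abs_ge (m : nat) z (d : R) : 0 <= d -> (forall h, H h -> d <= a (z - h)) ->
  d <= a (ev (chain m) z).
Proof.
move=> d0; elim: m z => [|m IH] z zd.
  by rewrite ev_mono qpow0 mul1r -[z]subr0 zd//; case: H_sub.
rewrite -(@ler_pXn2r _ q) ?nnegrE// chain_abs_succ -(prod_const_Fq d).
apply: ler_prod => c _; rewrite d0 /=; apply: IH => h Hh.
by rewrite -addrA -opprD zd//; have [_ HD _] := H_sub; apply: HD => //; exact: H_scale_x.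
Qed.

(* The sum of phi (z - y) over the F_q-combinations y of x_0, ..., x_(m-1), counted
   with multiplicity. *)
Fixpoint avg (phi : K -> R) (m : nat) (z : K) : R :=
  if m is k.+1 then \sum_c avg phi k (z - iota c * x k) else phi z.

Lemma chain_abs_le_avg phi (m : nat) z (B : R) : 0 <= B -> H z ->
  (forall h, H h -> a h <= B * expR (- phi h)) ->
  a (ev (chain m) z) ^+ (q ^ m) <= B ^+ (q ^ m) * expR (- avg phi m z).
Proof.
move=> B0 + phiB; elim: m z => [|m IH] z Hz.
  by rewrite expn0 !expr1 ev_mono qpow0 mul1r phiB.
rewrite !expnS !exprM chain_abs_succ -prodrXl -exprM mulnC exprM /= -sumrN expR_sum.
rewrite -prod_const_Fq -big_split /=.
apply: ler_prod => c _; rewrite exprn_ge0//= IH//.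
by apply: subspaceB => //; exact: H_scale_x.
Qed.

(** Translation by a multiple of [x i] only permutes the scalars in the corresponding summation. *)
Lemma avg_shift phi (m : nat) z c i : (i < m)%N ->
  avg phi m (z + iota c * x i) = avg phi m z.
Proof.
elim: m z => [//|m IH] z; rewrite ltnS leq_eqVlt => /orP[/eqP ->|im] /=.
  rewrite (reindex_inj (addrI c)) /=; apply: eq_bigr => d _.
  by rewrite rmorphD mulrDl opprD addrA addrK.
by apply: eq_bigr => d _; rewrite addrAC IH.
Qed.

Lemma avg_invariant phi (m : nat) z h : (forall y, phi (y + h) = phi y) ->
  avg phi m (z + h) = avg phi m z.
Proof.
move=> phiu; elim: m z => [|m IH] z //=.
by apply: eq_bigr => d _; rewrite addrAC IH.
Qed.

Lemma chain_limit h0 : H h0 -> (forall h, H h -> a h <= a h0) ->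
  (forall z, ~ H z -> exists2 d : R, 0 < d & forall h, H h -> d <= a (z - h)) ->
  (forall eps : R, 0 < eps -> exists N, forall m : nat, (N <= m)%N ->
     forall h, H h -> a (ev (chain m) h) <= eps) ->
  exists f, [/\ cF f, f 0 = 1,
    forall z, (forall h, H h -> a h <= a z) -> gauss_le f z (a z),
    forall z, ev f z = 0 <-> H z &
    forall G : set K, H `<=` G -> factors_through f G].
Proof.
move=> Hh0 h0max Hclosed decay.
have [f fF cf] : exists2 f, cF f & gauss_cvg chain f.
  apply: gauss_cauchy => [m|z eps eps0]; first exact: chain_calF.
  (* Enlarging [z] to [Z] makes the disc contain [H], as [chain_gauss] requires. *)
  have [Z [zZ h0Z]] : exists Z, a z <= a Z /\ a h0 <= a Z.
    by have [h|/ltW h] := leP (a z) (a h0); [exists h0 | exists z].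
  have [d d0 dP] := qpow_small (-1) eps0.
  have Z0 : 0 < a Z + 1 by rewrite ltr_wpDl.
  (* The cap at 1 bounds a power of exponent [q - 1 >= 1] by its base; the [+ 1] in the denominator
     covers [Z = 0]. *)
  have [|N NP] := decay (Num.min 1 (d / 2 / (a Z + 1))).
    by rewrite lt_min ltr01 !divr_gt0.
  exists N => m Nm; rewrite chainS.
  have := NP m Nm _ (xH m); rewrite le_min => /andP[d1 d2].
  apply: (gauss_le_sub zZ) => n; rewrite /kill_down addrAC subrr add0r mulNr absN.
  have ZP : gauss_le (chain m) Z (a Z).
    by apply: chain_gauss => i; exact: le_trans (h0max _ (xH i)) h0Z.
  apply: le_trans (gauss_le_lmul _ _ ZP n) _; rewrite -qpowM; apply/ltW/dP.
  rewrite absM absX; apply: le_lt_trans (half_lt d0).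
  apply: le_trans (_ : d / 2 / (a Z + 1) * a Z <= _).
    rewrite ler_wpM2r//; apply: le_trans d2.
    by rewrite -{1}(prednK qm1_gt0) exprS ler_piMr// exprn_ile1.
  by rewrite mulrAC ler_pdivrMr// ler_wpM2l ?lerDl// divr_ge0// ltW.
have f00 : f 0 = 1.
  apply: (@tends_unique _ _ _ (fun k : nat => chain k 0)); first exact: gauss_cvg_coef.
  by apply: (tends_eventually (N := 0%N) _ (tends_cst 1)) => m _; rewrite chain_coef0.
exists f; split=> //.
- move=> z zH n; have [->|z0] := eqVneq z 0; first by rewrite qpow_0 mulr0 abs0.
  have [|N NP] := cf z (a z); first by rewrite abs_gt0.
  rewrite -(subrK (chain N n) (f n)) mulrDl absD_le//; first exact: NP.
  by apply: chain_gauss => i; exact: zH.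
- move=> z; have fz := gauss_cvg_ev z chain_calF fF cf; split=> [z0|Hz].
    apply: contrapT => /Hclosed[d d0 dP]; have [N NP] := fz _ d0.
    have := NP N (leqnn _); rewrite z0 subr0 ltNge => /negP; apply.
    by apply: chain_abs_ge => //; exact: ltW.
  apply: (tends_unique fz) => eps eps0.
  have [|N NP] := decay (eps / 2); first by rewrite divr_gt0.
  exists N => m Nm; rewrite subr0; apply: le_lt_trans (half_lt eps0).
  exact: NP.
move=> G HG; apply: (factors_through_lim chain_calF fF cf (n0 := 0)).
  by rewrite f00 oner_neq0.
by move=> m; apply: chain_factors => i; exact/HG.
Qed.

End Chain.

(** * Compact sets in the ultrametric topology *)

Lemma open_abs (A : set K) :
  (forall y, A y -> exists2 e : R, 0 < e & forall z, a (y - z) < e -> A z) -> open A.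
Proof.
move=> Ao; rewrite openE => y /Ao[e e0 eA]; apply/nbhs_ballP.
by exists e => // z; exact: eA.
Qed.

Lemma compact_net (H : set K) (eps : R) : compact H -> 0 < eps ->
  exists s : seq K, (forall x, x \in s -> H x) /\
    forall h, H h -> exists2 x, x \in s & a (h - x) < eps.
Proof.
rewrite compact_cover => Hc eps0.
have [||D DH Hcov] := Hc K H (fun x => [set y | a (y - x) < eps]).
- move=> x _; apply: open_abs => y /= yx; exists eps => // z yz.
  by rewrite -(subrKA y) absD_lt// absBC.
- by move=> h Hh; exists h => //=; rewrite subrr abs0.
exists (enum_fset D); split=> [x xD|h /Hcov[x xD /= hx]]; last by exists x.
exact/set_mem/DH.
Qed.

Lemma compact_max (H : set K) : compact H -> H 0 ->
  exists2 h0, H h0 & forall h, H h -> a h <= a h0.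
Proof.
move=> Hc H0; have [allz|/existsNP[h1 /not_implyP[Hh1 /eqP h10]]] :=
    pselect (forall h, H h -> h = 0).
  by exists 0 => // h /allz ->.
have [|s [sH sP]] := compact_net Hc (_ : 0 < a h1); first by rewrite abs_gt0.
have [//|h0 h0s h0max] := seq_argmax (fun x => a x) (s := h1 :: s).
exists h0 => [|h /sP[x xs hx]].
  by move: h0s; rewrite inE => /orP[/eqP ->//|/sH].
rewrite -(subrK x h) absD_le//; last by rewrite h0max// inE xs orbT.
by rewrite (le_trans (ltW hx))// h0max// mem_head.
Qed.

Lemma compact_dist (H : set K) z : compact H -> H 0 -> ~ H z ->
  exists2 d : R, 0 < d & forall h, H h -> d <= a (z - h).
Proof.
rewrite compact_cover => Hc H0 Hz.
have pos h : H h -> 0 < a (z - h).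
  by move=> Hh; rewrite abs_gt0 subr_eq0; apply: contra_notN Hz => /eqP ->.
(* Away from [z] the distance to [z] is locally constant, so its level sets form an open cover and
   only finitely many distances occur. *)
have [||D DH Hcov] := Hc K H (fun x => [set y | a (z - y) = a (z - x)]).
- move=> x Hx; apply: open_abs => y /= yx; exists (a (z - x)) => [|t]; first exact: pos.
  by rewrite -yx => yt; rewrite -[z - t](subrKA y); exact: abs_domD.
- by move=> h Hh; exists h.
have [|h0 h0D h0min] := seq_argmin (fun x => a (z - x)) (s := enum_fset D).
  have [x xD _] := Hcov 0 H0; have : x \in enum_fset D by [].
  by case: (enum_fset D).
exists (a (z - h0)); first exact/pos/set_mem/DH.
by move=> h /Hcov[x xD /= ->]; exact: h0min.
Qed.

(** The sequence lists, through [pickle], finite nets of all meshes [1 / (k + 1)]; codes that name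
    no net point give 0, which lies in [H]. *)
Lemma compact_dense_seq (H : set K) : compact H -> H 0 ->
  exists2 x : nat -> K, forall i, H (x i) &
    forall eps : R, 0 < eps -> exists M, forall h, H h ->
      exists2 i, (i < M)%N & a (h - x i) < eps.
Proof.
move=> Hc H0.
have /choice[s sP] : forall k, exists s : seq K, (forall x, x \in s -> H x) /\
    forall h, H h -> exists2 x, x \in s & a (h - x) < k.+1%:R^-1.
  by move=> k; apply: compact_net => //; rewrite invr_gt0 ltr0Sn.
pose x (m : nat) :=
  if @choice.unpickle (nat * nat)%type m is Some (k, i) then nth 0 (s k) i else 0.
exists x => [i|eps eps0].
  rewrite /x; case: choice.unpickle => [[k j]|//].
  have [js|js] := ltnP j (size (s k)); last by rewrite nth_default.
  by apply: (sP k).1; exact: mem_nth.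
have [k keps] : exists k, k.+1%:R^-1 < eps.
  have e0 : 0 <= eps^-1 by rewrite invr_ge0 ltW.
  exists (Num.Def.archi_bound eps^-1); rewrite invf_plt ?posrE ?ltr0Sn//.
  by apply: lt_le_trans (archi_boundP e0) _; rewrite ler_nat.
pose F (i : 'I_(size (s k))) := choice.pickle (k, val i).
exists (\max_i F i).+1 => h /(sP k).2[y ys hy].
have yi : (index y (s k) < size (s k))%N by rewrite index_mem.
exists (choice.pickle (k, index y (s k))).
  by rewrite ltnS; exact: (leq_bigmax_cond (F := F) (Ordinal yi)).
by rewrite /x choice.pickleK nth_index// (lt_trans hy).
Qed.

(** * Haar averages *)

Section Haar.
Variables (x : nat -> K) (H : set K).
Hypotheses (H_sub : is_subspace iota H) (H_compact : compact H).
Hypothesis xH : forall i, H (x i).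
Variable mu : {measure set (borel a) -> \bar R}.
Hypothesis mu_haar : is_haar H mu.

Lemma borel_open (A : set K) : open A -> measurable (A : set (borel a)).
Proof. exact: sub_sigma_algebra. Qed.

Lemma compact_borel : measurable (H : set (borel a)).
Proof.
rewrite -[X in measurable X]setCK; apply: measurableC; apply: borel_open.
have [H0 _ _] := H_sub.
apply: open_abs => y /(compact_dist H_compact H0)[d d0 dP]; exists d => // z yz Hz.
by have := dP z Hz; rewrite leNgt yz.
Qed.

(* Such functions have open fibres, hence are Borel whatever the target. *)
Definition step_function (phi : K -> R) : Prop :=
  exists2 e : R, 0 < e & forall y h, a h < e -> phi (y + h) = phi y.

Lemma measurable_step (phi : K -> R) (D : set (borel a)) : step_function phi ->
  measurable D -> measurable_fun D (fun y : borel a => (phi y)%:E).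
Proof.
move=> [e e0 phie] mD _ Y mY; apply: measurableI => //; apply: borel_open.
apply: open_abs => y Yy; exists e => // z yz; rewrite /preimage /=.
by rewrite -(subrK y z) addrC phie// absBC.
Qed.

Lemma step_function_shift phi h : step_function phi -> step_function (fun y => phi (y + h)).
Proof.
move=> [e e0 phie]; exists e => // y k ke.
have -> : y + k + h = (y + h) + k by rewrite addrAC.
exact: phie.
Qed.

Lemma step_function_avg phi (m : nat) : step_function phi -> step_function (avg x phi m).
Proof.
by move=> [e e0 phie]; exists e => // y h he; apply: avg_invariant => z; exact: phie.
Qed.

Lemma avg_ge0 phi (m : nat) z : (forall y, 0 <= phi y) -> 0 <= avg x phi m z.
Proof. by move=> phi0; elim: m z => [|m IH] z //=; apply: sumr_ge0. Qed.

Lemma measurable_translation h :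
  measurable_fun [set: borel a] (fun y : borel a => (y + h : K) : borel a).
Proof.
refine (@measurability _ _ (borel a) (borel a) setT _ (@open K) erefl _) => _ [A oA <-].
rewrite setTI; apply: borel_open; move: oA; rewrite openE => oA.
apply: open_abs => y Ay; have /nbhs_ballP[e e0 eA] := oA _ Ay.
exists e => // z yz; apply: eA; rewrite ballE.
by have -> : y + h - (z + h) = y - z by ring.
Qed.

(** Translation by [h] preserves [H], and the pushforward of [mu] agrees with [mu] on Borel subsets
    of [H], the only ones the integral sees. *)
Lemma haar_integral_shift phi h : H h -> step_function phi -> (forall y, 0 <= phi y) ->
  (\int[mu]_(y in (H : set (borel a))) (phi (y + h))%:E =
   \int[mu]_(y in (H : set (borel a))) (phi y)%:E)%E.
Proof.
move=> Hh sphi phi0; have mH := compact_borel.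
have mt := measurable_translation h.
have := ge0_integral_pushforward mt mu mH (measurable_step sphi mH).
have -> : (fun y : borel a => (y + h : K) : borel a) @^-1` H = H.
  have [_ HD _] := H_sub.
  apply/seteqP; split=> y /= Hy; last exact: HD.
  by rewrite -(addrK h y); exact: subspaceB.
move=> <-; last by move=> y _; rewrite lee_fin.
apply: eq_measure_integral => A mA AH; rewrite /pushforward.
have HNh : H (- h) by exact: subspaceN.
rewrite -(mu_haar.2 _ _ HNh AH mA); congr (mu _).
apply/seteqP; split=> [y /= Ay|_ [y Ay <-] /=]; last by rewrite addrAC addNr add0r.
by exists (y + h) => //; rewrite addrC addrK.
Qed.

Lemma haar_integral_avg phi (m : nat) : step_function phi -> (forall y, 0 <= phi y) ->
  (\int[mu]_(y in (H : set (borel a))) (avg x phi m y)%:E =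
   (q ^ m)%:R%:E * \int[mu]_(y in (H : set (borel a))) (phi y)%:E)%E.
Proof.
move=> sphi phi0; have mH := compact_borel.
elim: m => [|m IH]; first by rewrite expn0 mul1e.
have HZ c : H (- (iota c * x m)).
  by apply: subspaceN => //; have [_ _] := H_sub; apply.
rewrite /=; under eq_integral do rewrite -sumEFin.
rewrite ge0_integral_sum//; first last.
- by move=> c y _; rewrite lee_fin avg_ge0.
- move=> c; apply: measurable_step => //; apply: (@step_function_shift (avg x phi m)).
  exact: step_function_avg.
rewrite (eq_bigr (fun=> 1%:E * ((q ^ m)%:R%:E *
    \int[mu]_(y in (H : set (borel a))) (phi y)%:E))%E); last first.
  move=> c _; rewrite (@haar_integral_shift (avg x phi m))// ?mul1e//.
    exact: step_function_avg.
  by move=> y; exact: avg_ge0.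
rewrite -ge0_sume_distrl; last by move=> c _; rewrite lee_fin.
by rewrite sumEFin sumr_const card_Fq muleA -EFinM -natrM -expnS.
Qed.

Definition dense_upto (M : nat) (e : R) : Prop :=
  forall h, H h -> exists2 i, (i < M)%N & a (h - x i) < e.

(** The average is constant on [H]: each point is within [e] of a killed point, translation by
    killed points is harmless by [avg_shift], and [phi] ignores translations smaller than [e]. *)
Lemma avg_haar phi (M m : nat) (e : R) : 0 < e -> (forall y, 0 <= phi y) ->
  (forall y h, a h < e -> phi (y + h) = phi y) -> dense_upto M e -> (M <= m)%N ->
  forall h, H h -> ((avg x phi m h)%:E * mu H =
    (q ^ m)%:R%:E * \int[mu]_(y in (H : set (borel a))) (phi y)%:E)%E.
Proof.
move=> e0 phi0 phie dM Mm h Hh; rewrite -haar_integral_avg//; last by exists e.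
rewrite -integral_cst; last exact: compact_borel.
have avg0 y : H y -> avg x phi m y = avg x phi m 0.
  move=> /dM[i iM yi]; have -> : y = 0 + iota 1 * x i + (y - x i).
    by rewrite rmorph1 mul1r add0r addrC subrK.
  by rewrite avg_invariant ?avg_shift// ?(leq_trans iM)// => z; exact: phie.
by apply: eq_integral => y /set_mem Hy; rewrite /= !avg0.
Qed.

(* The positive part of the valuation, truncated at height k. *)
Definition clip (k : nat) (y : K) : R :=
  Num.max 0 (- ln (Num.max (a y) (expR (- k%:R)))).

Lemma clip_ge0 k y : 0 <= clip k y.
Proof. by rewrite le_max lexx. Qed.

Lemma clip_invariant k y (h : K) : a h < expR (- k%:R) -> clip k (y + h) = clip k y.
Proof.
move=> hk; rewrite /clip; congr (Num.max 0 (- ln _)).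
have [yk|ky] := ltP (a y) (expR (- k%:R)).
  by rewrite !max_r ?ltW// absD_lt.
have -> : a (y + h) = a y by apply: abs_domD; exact: lt_le_trans ky.
by rewrite max_l.
Qed.

Lemma abs_le_clip k y (B : R) : 1 <= B -> a y <= B -> a y <= B * expR (- clip k y).
Proof.
move=> B1 yB; rewrite /clip; case: (leP 0 (- ln _)) => [_|_].
  rewrite opprK lnK ?posrE ?lt_max ?expR_gt0 ?orbT//.
  apply: le_trans (_ : 1 * a y <= _); first by rewrite mul1r.
  by rewrite ler_pM// le_max lexx.
by rewrite oppr0 expR0 mulr1.
Qed.

Lemma clip_nondecreasing y : {homo (fun k => (clip k y)%:E) : k l / (k <= l)%N >-> (k <= l)%E}.
Proof.
have max_mono (c b b' : R) : b <= b' -> Num.max c b <= Num.max c b'.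
  by move=> bb'; rewrite ge_max !le_max lexx bb' orbT.
have pos (k : nat) : 0 < Num.max (a y) (expR (- k%:R)) by rewrite lt_max expR_gt0 orbT.
move=> k l kl; rewrite lee_fin; apply: (max_mono); rewrite lerN2 ler_ln ?posrE//.
by apply: max_mono; rewrite ler_expR lerN2 ler_nat.
Qed.

Lemma clip_lim y : limn (fun k => (clip k y)%:E) = ((@valuation R C0 a)^\+ y)%E.
Proof.
rewrite funeposE /valuation; have [->|y0] := eqVneq y 0.
  rewrite max_l ?leey//; apply/cvg_lim => //.
  have -> : (fun k => (clip k 0)%:E) = (fun k : nat => (k%:R : R)%:E).
    apply/funext => k; rewrite /clip abs0 [Num.max 0 (expR _)]max_r ?expR_ge0//.
    by rewrite expRK opprK max_r.
  by apply/cvgenyP.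
rewrite -EFin_max; apply: lim_near_cst => //.
have ay : 0 < a y by rewrite abs_gt0.
exists (Num.Def.archi_bound `|ln (a y)|) => // k /= kN.
congr (_%:E); rewrite /clip maxC; congr (Num.max (- ln _) _).
rewrite max_l// -ler_ln ?posrE ?expR_gt0// expRK lerNl.
have := archi_boundP (normr_ge0 (ln (a y))); rewrite ltr_norml => /andP[+ _].
rewrite ltrNl => /ltW/le_trans; apply; rewrite ler_nat//.
Qed.

Lemma clip_integral_unbounded (A : R) :
  (\int[mu]_(y in (H : set (borel a))) @valuation R C0 a y = +oo)%E ->
  exists k, (A%:E <= \int[mu]_(y in (H : set (borel a))) (clip k y)%:E)%E.
Proof.
rewrite integralE => Hoo; have mH := compact_borel.
(* Subtracting the nonnegative integral of the negative part gives [+oo] only if the positive part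
   already has infinite integral. *)
have poo : (\int[mu]_(y in (H : set (borel a))) ((@valuation R C0 a)^\+ y) = +oo)%E.
  move: Hoo; have := integral_ge0 mu (D := (H : set (borel a)))
    (fun y _ => funeneg_ge0 (@valuation R C0 a) y).
  by case: (integral _ _ (funeneg _)); case: (integral _ _ (funepos _)).
have clip_cvg : (\int[mu]_(y in (H : set (borel a))) (clip k y)%:E)%E @[k --> \oo] --> +oo%E.
  have -> : +oo%E = (\int[mu]_(y in (H : set (borel a))) limn (fun k => (clip k y)%:E))%E.
    by rewrite -poo; apply: eq_integral => y _; rewrite clip_lim.
  apply: cvg_monotone_convergence => //.
  - move=> k; apply: measurable_step => //; exists (expR (- k%:R)); first exact: expR_gt0.
    by move=> y h; exact: clip_invariant.
  - by move=> k y _; rewrite lee_fin clip_ge0.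
  - by move=> y _ k l kl; exact: clip_nondecreasing.
by have [k _ kA] := (cvgeyPge _).1 clip_cvg A; exists k; apply: kA => /=.
Qed.

(** [A] is chosen with [B * exp (- A) <= eps], then [k] so that the Haar average of [clip k] is at
    least [A], then [M] so that the killed points are dense at scale [exp (- k)]; none of these
    depends on [h]. *)
Lemma chain_decay (h0 : K) : H h0 -> (forall h, H h -> a h <= a h0) ->
  (forall e : R, 0 < e -> exists M, dense_upto M e) ->
  (\int[mu]_(y in (H : set (borel a))) @valuation R C0 a y = +oo)%E ->
  forall eps : R, 0 < eps -> exists N, forall m : nat, (N <= m)%N ->
    forall h, H h -> a (ev (chain x m) h) <= eps.
Proof.
move=> Hh0 h0max dense Hoo eps eps0; pose B := Num.max 1 (a h0).
have B1 : 1 <= B by rewrite le_max lexx.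
have B0 : 0 < B by exact: lt_le_trans B1.
have [A AP] : exists A : R, B * expR (- A) <= eps.
  exists (ln (B / eps)); rewrite expRN lnK ?posrE ?divr_gt0//.
  by rewrite invf_div mulrC divfK ?gt_eqF.
have /andP[muH0 muHoo] := mu_haar.1; pose c := fine (mu H).
have muHE : mu H = c%:E by rewrite fineK// ge0_fin_numE// ltW.
have c0 : 0 < c by rewrite -lte_fin -muHE.
have [k kP] := clip_integral_unbounded (A * c) Hoo.
have [M MP] := dense _ (expR_gt0 (- k%:R)); exists M => m Mm h Hh.
have avgA : (q ^ m)%:R * A <= avg x (clip k) m h.
  rewrite -(ler_pM2r c0) -mulrA -lee_fin [leRHS]EFinM -muHE.
  rewrite (avg_haar (expR_gt0 _) (clip_ge0 k) (@clip_invariant k) MP Mm Hh).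
  by rewrite EFinM lee_wpmul2l// lee_fin.
have qm0 : (0 < q ^ m)%N by rewrite expn_gt0 q_gt0.
apply: le_trans AP; rewrite -(@ler_pXn2r _ (q ^ m)) ?nnegrE ?mulr_ge0 ?expR_ge0 ?(ltW B0)//.
have clipB y : H y -> a y <= B * expR (- clip k y).
  by move=> Hy; apply: abs_le_clip => //; rewrite le_max h0max ?orbT.
apply: le_trans (chain_abs_le_avg H_sub xH m (ltW B0) Hh clipB) _.
rewrite exprMn ler_wpM2l ?exprn_ge0 ?(ltW B0)// -expRM_natl ler_expR mulrN lerN2.
exact: avgA.
Qed.

End Haar.

(** * Cosets of [H] meeting a ball, and the kernel [H] *)

Lemma coset_eq (H : set K) y z h : is_subspace iota H -> H h -> y + h = z ->
  [set y + k | k in H] = [set z + k | k in H].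
Proof.
move=> HH Hh yz; have [_ HD _] := HH.
apply/seteqP; split=> _ [k Hk <-].
  by exists (k - h); [exact: subspaceB | rewrite -yz; ring].
by exists (h + k); [exact: HD | rewrite -yz; ring].
Qed.

(** If there are infinitely many cosets, a bijection with the naturals gives representatives tending
    to infinity. An element of absolute value at most [rho] has its representative within
    [max rho r], which leaves finitely many. *)
Lemma cosets_in_ball (G : set K) (r rho : R) :
  let H := G `&` @Delta R C0 a r in is_subspace iota G -> is_subspace iota H ->
  countable (cosets H G) ->
  (infinite_set (cosets H G) -> forall g : nat -> K, coset_reps H G g ->
     a (g k) @[k --> \oo] --> +oo) ->
  exists s : seq K, (forall y, y \in s -> G y) /\
    forall g : K, G g -> a g <= rho -> exists2 y, y \in s & H (g - y).
Proof.
move=> H GS HS cG reps; have [G0 GD GZ] := GS; have [H0 _ _] := HS.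
pose rep (A : set K) := xget 0 A.
have repP A : cosets H G A -> A (rep A).
  by move=> [y Gy <-]; apply: xgetPex; exists (y + 0); exists 0.
have sub A : cosets H G A -> A `<=` G.
  by move=> [y Gy <-] _ [h [Gh _] <-]; exact: GD.
have diff A y z : cosets H G A -> A y -> A z -> H (y - z).
  move=> [t Gt <-] [h Hh <-] [k Hk <-].
  have -> : t + h - (t + k) = h - k by ring.
  exact: subspaceB.
have cosetP (g : K) : G g -> cosets H G [set g + k | k in H] by move=> Gg; exists g.
have memc (g : K) : [set g + k | k in H] g by exists 0; rewrite ?addr0.
have [fin|inf] := pselect (finite_set (cosets H G)).
  have /finite_seqP[s sE] := finite_image rep fin.
  exists s; split=> [y ys|g Gg _].
    have : [set` s] y by [].
    rewrite -sE => -[A cA <-]; exact: (sub _ cA _ (repP _ cA)).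
  exists (rep [set g + k | k in H]).
    suff : [set` s] (rep [set g + k | k in H]) by [].
    by rewrite -sE; exists [set g + k | k in H] => //; exact: cosetP.
  exact: (diff _ _ _ (cosetP _ Gg) (memc g) (repP _ (cosetP _ Gg))).
have /card_set_bijP[c [c_co c_inj c_surj]] : ([set: nat] #= cosets H G)%card.
  by rewrite card_eq_sym; exact: eq_card_nat.
have cc k : cosets H G (c k) by exact: c_co.
pose g k := rep (c k).
have gc k : c k (g k) by exact: repP.
have gP : coset_reps H G g.
  split=> [k|A cA]; first by apply: sub (gc k); exact: cc.
  have [k _ kA] := c_surj _ cA; exists k; split; first by rewrite -kA.
  move=> l Al; apply: c_inj; rewrite ?in_setT// kA; symmetry.
  have := gc l; have := cA => -[t Gt tA]; have := cc l => -[t' Gt' t'A].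
  rewrite -{1}t'A => -[h Hh ht']; move: Al; rewrite -tA => -[h' Hh' ht].
  rewrite -t'A; apply: (@coset_eq H _ _ (h - h')) => //; first exact: subspaceB.
  by rewrite addrA ht' -ht addrK.
have /cvgryPge/(_ (Num.max rho r + 1))[N _ NP] := reps inf g gP.
exists (map g (seq.iota 0 N)); split=> [_ /mapP[k _ ->]|y Gy yrho].
  by apply: sub (gc k); exact: cc.
have [k _ kE] := c_surj _ (cosetP _ Gy).
have Hyk : H (y - g k).
  by apply: (diff _ _ _ (cosetP _ Gy)); [exact: memc | rewrite -kE].
exists (g k) => //; apply: map_f; rewrite mem_iota /= add0n ltnNge; apply/negP => Nk.
have := NP k Nk; rewrite leNgt => /negP; apply.
apply: le_lt_trans (_ : Num.max rho r < _); last by rewrite ltrDl.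
rewrite -[g k](subKr y) absB_le// le_max ?yrho//.
by apply/orP; right; case: Hyk.
Qed.

Lemma compact_kernel (H : set K) (mu : {measure set (borel a) -> \bar R}) :
  is_subspace iota H -> compact H -> is_haar H mu ->
  (\int[mu]_(y in (H : set (borel a))) @valuation R C0 a y = +oo)%E ->
  exists f, [/\ cF f, f 0 = 1,
    forall z, (forall h, H h -> a h <= a z) -> gauss_le f z (a z),
    forall z, ev f z = 0 <-> H z &
    forall G : set K, H `<=` G -> factors_through f G].
Proof.
move=> HS Hc mu_haar Hoo; have [H0 _ _] := HS.
have [h0 Hh0 h0max] := compact_max Hc H0.
have [x xH xdense] := compact_dense_seq Hc H0.
apply: (@chain_limit x H HS xH h0) => // [z Hz|]; first exact: compact_dist.
exact: (chain_decay HS Hc xH mu_haar Hh0 h0max xdense Hoo).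
Qed.

Lemma ev_series0 z : ev (fun=> 0) z = 0.
Proof. by rewrite /tau_eval (@zsum1 _ 0) /tau_terms ?mul0r// => n _; rewrite mul0r. Qed.

Lemma kill_up_neq0 f x n0 : cF f -> f n0 != 0 -> exists n, kill_up f x n != 0.
Proof.
move=> fF fn0; apply: contrapT => /forallNP all0.
have {}all0 : kill_up f x = fun=> 0.
  by apply/funext => n; apply/eqP; apply: contrapT => /negP/all0.
have ev0 z : ev (kill_up f x) z = 0 by rewrite all0 ev_series0.
have [fx|fx] := eqVneq (ev f x) 0.
  have [w w1 _] := tau_solve 1 fF fn0.
  by have := ev0 w; rewrite ev_kill_up// w1 fx mul0r subr0 => /eqP; rewrite oner_eq0.
have [t tE] : exists t : K, t ^+ q - t = 1.
  have : size ('X^q - 'X - 1%:P : {poly K}) != 1%N.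
    rewrite -addrA -opprD size_polyDl; first by rewrite size_polyXn eqSS -lt0n.
    by rewrite size_polyN size_XaddC size_polyXn ltnS.
  move=> /closed_rootP[t]; rewrite rootE !hornerE subr_eq0 => /eqP tE; by exists t.
(* With [d = f x], [f w = d t] and [t ^ q - t = 1], the value of [kill_up f x] at [w] is [- d]. *)
have [w wt _] := tau_solve (ev f x * t) fF fn0.
have := ev0 w; rewrite ev_kill_up// wt [ev f x * t / _]mulrAC divff// mul1r.
by rewrite -mulrBr -opprB tE mulrN1 => /eqP; rewrite oppr_eq0 (negPf fx).
Qed.

Lemma abs_tau_up (d w : K) : d != 0 -> a (d * (w / d) ^+ q) = a w * (a w / a d) ^+ q.-1.
Proof.
move=> d0; rewrite absM absX absf -{1}(prednK q_gt0) exprS mulrA [a d * _]mulrC.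
by rewrite divfK// abs_eq0.
Qed.

(** * From H to G *)

Section Up.
Variables (G H : set K) (f0 : tau_series a) (r : R).
Hypotheses (G_sub : is_subspace iota G) (HE : H = G `&` @Delta R C0 a r).
Hypothesis H_compact : compact H.
Hypothesis balls : forall rho : R, exists s : seq K, (forall y, y \in s -> G y) /\
  forall g : K, G g -> a g <= rho -> exists2 y, y \in s & H (g - y).
Hypotheses (f0F : cF f0) (f0_1 : f0 0 = 1)
  (f0_gauss : forall z, (forall h, H h -> a h <= a z) -> gauss_le f0 z (a z))
  (f0_ker : forall z, ev f0 z = 0 <-> H z)
  (f0_factors : factors_through f0 G).

Definition is_next f y : Prop :=
  [/\ G y, ev f y != 0 & forall z, G z -> ev f z != 0 -> a y <= a z].

(** If no such point exists the default is 0, which lies in [G] and for which [kill_up] changes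
    nothing; so [up] is defined at every stage. *)
Definition next f : K := xget 0 (is_next f).

Fixpoint up (k : nat) : tau_series a :=
  if k is l.+1 then kill_up (up l) (next (up l)) else f0.

Let d k := ev (up k) (next (up k)).

Lemma upS k : up k.+1 = kill_up (up k) (next (up k)). Proof. by []. Qed.

Lemma G_next f : G (next f).
Proof. by rewrite /next; case: xgetP => [y _ []//|_]; case: G_sub. Qed.

Lemma upF k : cF (up k).
Proof. by elim: k => [//|k IH]; exact: calF_kill_up. Qed.

Lemma up_factors k : factors_through (up k) G.
Proof.
by elim: k => [//|k IH]; apply: factors_kill_up => //; [exact: upF | exact: G_next].
Qed.

Lemma up_neq0 k : exists n, up k n != 0.
Proof.
elim: k => [|k [n kn]]; first by exists 0; rewrite /= f0_1 oner_neq0.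
exact: kill_up_neq0 (upF k) kn.
Qed.

Lemma up_kerS k z : ev (up k) z = 0 -> ev (up k.+1) z = 0.
Proof.
move=> z0; rewrite /= ev_kill_up ?z0; last exact: upF.
by rewrite mul0r expr0n -leqn0 leqNgt q_gt0 mulr0 subr0.
Qed.

Lemma up_ker_le k l z : (k <= l)%N -> ev (up k) z = 0 -> ev (up l) z = 0.
Proof.
move=> kl z0; rewrite -(subnK kl); elim: (l - k)%N => [//|j IH].
by rewrite addSn; exact: up_kerS.
Qed.

Lemma H_up_ker k h : H h -> ev (up k) h = 0.
Proof. by move=> Hh; apply: (@up_ker_le 0) => //; exact/f0_ker. Qed.

Lemma up_ker_sub k z : ev (up k) z = 0 -> G z.
Proof.
elim: k z => [|k IH] z /=; first by move=> /f0_ker; rewrite HE => -[].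
have kF := upF k; have [d0|d0] := eqVneq (d k) 0.
  by rewrite ev_kill_up// -/(d k) d0 mul0r subr0; exact: IH.
move=> /(kill_up_eq0 _ kF d0)[c /IH Gz].
have [_ GD GZ] := G_sub; rewrite -(subrK (iota c * next (up k)) z).
by apply: (GD) => //; apply: (GZ); exact: G_next.
Qed.

Lemma up_ker_coset k y z : H (y - z) -> ev (up k) y = ev (up k) z.
Proof.
by move=> /(H_up_ker k); rewrite evBr; [move=> /subr0_eq | exact: upF].
Qed.

(** * The case in which the killing process never ends *)

Section Infinite.
Hypothesis incomplete : forall k, exists2 y, G y & ev (up k) y != 0.

Lemma G_notH y : G y -> ~ H y -> r < a y.
Proof. by move=> Gy Hy; rewrite ltNge; apply/negP => yr; apply: Hy; rewrite HE. Qed.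

Lemma abs_coset y z : G y -> ~ H y -> H (y - z) -> a z = a y.
Proof.
move=> Gy Hy; rewrite HE => -[_ yz]; apply: abs_close.
exact: le_lt_trans yz (G_notH Gy Hy).
Qed.

Lemma up_notH k y : ev (up k) y != 0 -> ~ H y.
Proof. by move=> + /(H_up_ker k) y0; rewrite y0 eqxx. Qed.

(** Finitely many cosets of [H] meet a ball, and on the part of [G] not yet killed both [|y|] and
    the value of [up k] depend only on the coset, so a minimum exists. *)
Lemma nextP k : is_next (up k) (next (up k)).
Proof.
rewrite /next; apply: xgetPex; have [g Gg gk] := incomplete k.
have [s [sG sP]] := balls (a g).
pose s' := [seq y <- s | ev (up k) y != 0].
have s'P z : G z -> ev (up k) z != 0 -> a z <= a g ->
    exists2 y, y \in s' & a y = a z.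
  move=> Gz zk zg; have [y ys Hzy] := sP z Gz zg; exists y.
    by rewrite mem_filter ys andbT -(up_ker_coset k Hzy).
  exact: (abs_coset Gz (up_notH zk) Hzy).
have [y0 y0s y0g] := s'P g Gg gk (lexx _).
have [|y ys ymin] := seq_argmin (fun y => a y) (s := s'); first by case: (s') y0s.
move: (ys); rewrite mem_filter => /andP[yk ys']; exists y; split=> //; first exact: sG.
move=> z Gz zk; have [zg|gz] := leP (a z) (a g).
  by have [t ts <-] := s'P z Gz zk zg; exact: ymin.
by apply: le_trans (ltW gz); rewrite -y0g ymin.
Qed.

Lemma d_neq0 k : d k != 0. Proof. by have [] := nextP k. Qed.

Lemma next_neq0 k : next (up k) != 0.
Proof. by apply: contra_neq (d_neq0 k) => y0; rewrite /d y0 ev0r//; exact: upF. Qed.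

Lemma next_mono k l : (k <= l)%N -> a (next (up k)) <= a (next (up l)).
Proof.
move=> kl; have [_ _ kmin] := nextP k; apply: kmin; first exact: G_next.
by apply: contra_neq (d_neq0 l) => /(up_ker_le kl).
Qed.

Lemma next_gt_r k : r < a (next (up k)).
Proof. by apply: G_notH; [exact: G_next | exact/up_notH/d_neq0]. Qed.

Lemma up_next_eq0 k : ev (up k.+1) (next (up k)) = 0.
Proof.
apply/(kill_up_eq0 _ (upF k) (d_neq0 k)); exists 1.
by rewrite rmorph1 mul1r subrr ev0r//; exact: upF.
Qed.

(** As long as the next point stays within [rho], each step kills a further member of a finite list
    of representatives, so the count [live] would decrease forever. *)
Lemma next_unbounded (rho : R) : exists N, forall k, (N <= k)%N -> rho < a (next (up k)).
Proof.
suff [N NP] : exists N, rho < a (next (up N)).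
  by exists N => k Nk; exact: lt_le_trans (next_mono Nk).
apply: contrapT => /forallNP small; have [s [sG sP]] := balls rho.
pose live k := count (fun y => ev (up k) y != 0) s.
have live_lt k : (live k.+1 < live k)%N.
  have le_rho : a (next (up k)) <= rho by rewrite leNgt; apply/negP/small.
  have [y ys Hy] := sP _ (G_next (up k)) le_rho.
  have yk : ev (up k) y != 0 by rewrite -(up_ker_coset k Hy) d_neq0.
  have yk1 : ev (up k.+1) y = 0 by rewrite -(up_ker_coset k.+1 Hy) up_next_eq0.
  apply: (count_lt (y := y)) => //; last by rewrite yk1 eqxx.
  by move=> z; apply: contra_neq; exact: up_kerS.
have liveD k : (live k + k <= live 0)%N.
  elim: k => [|k IH]; first by rewrite addn0.
  by rewrite addnS -addSn (leq_trans _ IH)// leq_add2r live_lt.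
by have := liveD (live 0).+1; rewrite addnS ltnNge leq_addl.
Qed.

(** The controlled solution [w] of [f w = d k] differs from the next point by a kernel element, so
    it lies in [G] and is not killed; minimality gives [|next| <= |w|]. *)
Lemma up_gauss_next k : gauss_le (up k) (next (up k)) (a (d k)).
Proof.
have [n kn] := up_neq0 k; have [w wd gw] := tau_solve (d k) (upF k) kn.
have [_ _ kmin] := nextP k; apply: (gauss_le_sub _ gw); apply: kmin.
  have [_ GD _] := G_sub; rewrite -(subrK (next (up k)) w); apply: GD; last exact: G_next.
  by apply: (@up_ker_sub k); rewrite evBr ?wd ?subrr//; exact: upF.
by rewrite wd d_neq0.
Qed.

Lemma up_lmul_gauss k z (w : K) : gauss_le (up k) z (a w) ->
  gauss_le (fun n => up k.+1 n - up k n) z (a w * (a w / a (d k)) ^+ q.-1).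
Proof.
move=> kw n; rewrite upS /kill_up addrAC subrr add0r mulNr absN.
apply: le_trans (gauss_le_lmul _ _ kw n) _.
by rewrite qpow1 -(abs_tau_up _ (d_neq0 k)) expr_div_n mulrAC mulrA.
Qed.

Lemma ratio_le1 (t D : R) : 0 <= t -> t <= D -> t * (t / D) ^+ q.-1 <= t.
Proof.
move=> t0 tD; rewrite ler_piMr// exprn_ile1//.
  by rewrite divr_ge0// (le_trans t0).
have [D0|D0] := eqVneq D 0; first by rewrite D0 invr0 mulr0 ler01.
by rewrite ler_pdivrMr ?mul1r// lt_def D0 (le_trans t0).
Qed.

(** Up to the radius of the next point the Gauss norm of [up k] is at most [|d k|], so the
    correction does not exceed it. *)
Lemma up_gaussS k z (w : K) : a z <= a (next (up k)) -> gauss_le (up k) z (a w) ->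
  gauss_le (up k.+1) z (a w).
Proof.
move=> zk kw; have [m mmax] := gauss_argmax z (upF k).
have lt_d : a (up k m * qp m z) <= a (d k) by exact: (gauss_le_sub zk (up_gauss_next k)).
have le_w := kw m; move=> n.
rewrite -(subrK (up k n) (up k.+1 n)) mulrDl absD_le//.
apply: le_trans (up_lmul_gauss mmax n) _.
by apply: le_trans le_w; apply: ratio_le1.
Qed.

Lemma up_gauss_bounded z : exists (N : nat) (w : K),
  forall k, (N <= k)%N -> gauss_le (up k) z (a w).
Proof.
have [N NP] := next_unbounded (a z); have [m mmax] := gauss_argmax z (upF N).
exists N, (up N m * qp m z) => k Nk; rewrite -(subnK Nk).
elim: (k - N)%N => [//|j IH]; rewrite addSn; apply: up_gaussS => //.
by apply/ltW/NP; rewrite leq_addl.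
Qed.

(** If [H] is nonzero, a largest element of [H] will do; otherwise the first next point is divided
    by a next point of absolute value above 1. *)
Lemma small_radius : exists z : K, [/\ z != 0, forall h, H h -> a h <= a z &
  forall k, a z < a (next (up k))].
Proof.
have H0 : H 0 by apply/f0_ker; rewrite ev0r.
have [h0 Hh0 h0max] := compact_max H_compact H0.
have [h00|h00] := eqVneq h0 0; last first.
  exists h0; split=> // k; apply: le_lt_trans (next_gt_r k).
  by move: Hh0; rewrite HE => -[].
have [N NP] := next_unbounded 1; exists (next (up 0) / next (up N)); split.
- by rewrite mulf_neq0 ?invr_eq0 ?next_neq0.
- by move=> h /h0max; rewrite h00 abs0 => /le_trans; apply.
- move=> k; apply: lt_le_trans (next_mono (leq0n k)).
  have gt1 := NP N (leqnn _).
  rewrite absf ltr_pdivrMr ?(lt_trans ltr01)// ltr_pMr// abs_gt0.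
  exact: next_neq0.
Qed.

(** At a radius strictly below all next points the correction is strictly smaller than [|z|], so it
    cannot change the absolute value of the coefficient at 0. *)
Lemma up_coef0 k : a (up k 0) = 1.
Proof.
have [z [z0 zH zk]] := small_radius; have az : 0 < a z by rewrite abs_gt0.
suff : a (up k 0) = 1 /\ gauss_le (up k) z (a z) by case.
elim: k => [|k [k1 kz]]; first by rewrite /= f0_1 abs1; split=> //; exact: f0_gauss.
split; last by apply: up_gaussS => //; exact: ltW.
have dk : a z < a (d k).
  apply: lt_le_trans (zk k) _; have := up_gauss_next k 0.
  by rewrite qpow0 absM k1 mul1r.
have := up_lmul_gauss kz 0; rewrite qpow0 absM mulrC ler_pM2l// => h.
rewrite -(subrK (up k 0) (up k.+1 0)) addrC abs_domD// k1 (le_lt_trans h)//.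
rewrite exprn_ilt1 ?divr_ge0//; first by rewrite -lt0n.
by rewrite ltr_pdivrMr ?mul1r// (lt_trans az).
Qed.

Lemma d_ge k : a (next (up k)) <= a (d k).
Proof. by have := up_gauss_next k 0; rewrite qpow0 absM up_coef0 mul1r. Qed.

Lemma up_cauchy z (eps : R) : 0 < eps -> exists N, forall k, (N <= k)%N ->
  gauss_le (fun n => up k.+1 n - up k n) z eps.
Proof.
move=> eps0; have [N [w wP]] := up_gauss_bounded z.
(* The first summand forces [|w| <= |d k|], the second [|w| * |w| / |d k| <= eps]. *)
have [M MP] := next_unbounded (a w + a w * a w / eps).
exists (maxn N M) => k; rewrite geq_max => /andP[Nk Mk].
have dk := lt_le_trans (MP k Mk) (d_ge k).
have wd : a w <= a (d k).
  by apply: le_trans (ltW dk); rewrite lerDl divr_ge0 ?mulr_ge0// ltW.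
have d0 : 0 < a (d k) by rewrite abs_gt0 d_neq0.
apply: gauss_le_trans (up_lmul_gauss (wP k Nk)).
apply: le_trans (_ : a w * (a w / a (d k)) <= _).
  rewrite ler_wpM2l// -{1}(prednK qm1_gt0) exprS ler_piMr ?divr_ge0// exprn_ile1 ?divr_ge0//.
  by rewrite ler_pdivrMr ?mul1r.
rewrite mulrA ler_pdivrMr// [eps * _]mulrC -ler_pdivrMr//.
by apply: le_trans (ltW dk); rewrite lerDr.
Qed.

Lemma up_limit : exists f, [/\ cF f, exists n, f n != 0,
  forall z, ev f z = 0 <-> G z & factors_through f G].
Proof.
have [f fF cf] := gauss_cauchy upF up_cauchy.
have fn0 : f 0 != 0.
  apply/eqP => f00; have [N NP] := gauss_cvg_coef 0 cf ltr01.
  by have := NP N (leqnn _); rewrite f00 subr0 up_coef0 ltxx.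
exists f; split=> //; first by exists 0.
  move=> z; have fz := gauss_cvg_ev z upF fF cf; split=> [fz0|Gz].
    apply: contrapT => Gz.
    have zk k : ev (up k) z != 0 by apply/eqP => /up_ker_sub.
    have [N [w wP]] := up_gauss_bounded z; have [M MP] := next_unbounded (a w).
    (* Once [|d k|] exceeds the bound on [|up k z|], each correction is strictly smaller than the
       value, whose absolute value is therefore eventually constant and nonzero. *)
    have cst k : (maxn N M <= k)%N -> a (ev (up k) z) = a (ev (up (maxn N M)) z).
      move=> NMk; rewrite -(subnK NMk); elim: (k - maxn N M)%N => [//|j <-].
      rewrite addSn; set l := (j + maxn N M)%N; have lF := upF l.
      have [Nl Ml] : (N <= l)%N /\ (M <= l)%N by rewrite /l; lia.
      have evw := ev_gauss lF (wP l Nl).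
      have lt_d : a (ev (up l) z) < a (d l).
        by apply: le_lt_trans evw _; apply: lt_le_trans (d_ge l); exact: MP.
      rewrite upS ev_kill_up// abs_domD// absN abs_tau_up ?d_neq0//.
      rewrite gtr_pMr ?abs_gt0// exprn_ilt1 ?divr_ge0//; first by rewrite -lt0n.
      by rewrite ltr_pdivrMr ?mul1r// (le_lt_trans _ lt_d).
    have zNM : 0 < a (ev (up (maxn N M)) z) by rewrite abs_gt0.
    have [L LP] := fz _ zNM; have := LP (maxn L (maxn N M)) (leq_maxl _ _).
    by rewrite fz0 subr0 cst ?leq_maxr// ltxx.
  have [k kz] : exists k, ev (up k) z = 0.
    apply: contrapT => /forallNP nz; have [N NP] := next_unbounded (a z).
    have [_ _ /(_ z Gz)] := nextP N; rewrite leNgt NP// => h.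
    by have /eqP := nz N => /h.
  apply: (tends_unique fz); apply: (tends_eventually (N := k) _ (tends_cst 0)).
  by move=> l kl; rewrite (up_ker_le kl).
exact: (factors_through_lim upF fF cf fn0 up_factors).
Qed.

End Infinite.

(** Either some stage already vanishes on all of [G], or every stage has a next point and the limit
    is taken. *)
Lemma discrete_extension : exists f, [/\ cF f, exists n, f n != 0,
  forall z, ev f z = 0 <-> G z & factors_through f G].
Proof.
have [[k kP]|/forallNP inc] := pselect (exists k, forall y, G y -> ev (up k) y = 0).
  exists (up k); split; [exact: upF | exact: up_neq0 | | exact: up_factors].
  by move=> z; split; [exact: up_ker_sub | exact: kP].
apply: up_limit => k; have /existsNP[y /not_implyP[Gy /eqP yk]] := inc k.
by exists y.
Qed.

End Up.

(** * Uniqueness *)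

Lemma kernel_unique f g n0 : cF f -> f n0 != 0 ->
  factors_through f (tau_ker q f) -> cF g -> tau_ker q g = tau_ker q f ->
  exists (eps : K) (n : int), eps != 0 /\ g = tau_comp q (tau_mono eps n) f.
Proof.
move=> fF fn0 ffac gF gker.
have gf z : ev g z = 0 <-> ev f z = 0.
  by rewrite -[X in X <-> _]/(tau_ker q g z) gker.
have [u uF uE] := ffac g gF (fun z => (gf z).2).
(* Every [y] is a value [f w], so [u y = 0] means [g w = 0], hence [f w = 0]. *)
have u_inj y : ev u y = 0 -> y = 0.
  by have [w <- _] := tau_solve y fF fn0; rewrite uE => /gf.
have [k uk] : exists k, u k != 0.
  apply: contrapT => /forallNP all0.
  have u0 : u = fun=> 0 by apply/funext => n; apply/eqP; apply: contrapT => /negP/all0.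
  have := u_inj 1; rewrite u0 ev_series0 => /(_ erefl)/eqP.
  by rewrite oner_eq0.
have uM : u = tau_mono (u k) k.
  apply/funext => n; rewrite /tau_mono; case: eqP => [->//|nk]; apply/eqP.
  by apply: contrapT => /negP un; apply: nk; exact: (injective_monomial uF u_inj).
exists (u k), k; split=> //; rewrite tau_comp_mono.
apply: tau_eval_inj => // [|z]; first exact: calF_lmul.
by rewrite ev_lmul// -uE uM ev_mono /tau_mono eqxx.
Qed.

(** * Application to the class [calG] *)

(** A scalar fixed by Frobenius cannot exceed 1 in absolute value, as its [q]-th power would be
    strictly larger. *)
Lemma abs_iota_le1 c : a (iota c) <= 1.
Proof.
rewrite leNgt; apply/negP => c1.
have := congr1 (nabs a) (iota_frob c) => /eqP.
rewrite absX -(prednK q_gt0) exprS gt_eqF// ltr_pMr ?(lt_trans ltr01)//.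
by rewrite exprn_egt1// -lt0n.
Qed.

Lemma subspace_ball (G : set K) (r : R) : 0 <= r -> is_subspace iota G ->
  is_subspace iota (G `&` @Delta R C0 a r).
Proof.
move=> r0 [G0 GD GZ]; split; first by split=> //; rewrite /Delta /= abs0.
  by move=> y z [Gy yr] [Gz zr]; split; [exact: GD | exact: absD_le].
move=> c y [Gy yr]; split; first exact: GZ.
by rewrite /Delta /= absM (le_trans _ yr)// ler_piMl// abs_iota_le1.
Qed.

Lemma calG_kernel (G : set K) (r : R) : 0 <= r -> calG iota r G ->
  exists f, [/\ cF f, tau_ker q f = G &
    forall g, cF g -> tau_ker q g = G ->
      exists (eps : K) (n : int), eps != 0 /\ g = tau_comp q (tau_mono eps n) f].
Proof.
move=> r0 [GS Hc [mu [mu_haar Hoo]] [cG reps]].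
have HS := subspace_ball r0 GS.
have [f0 [f0F f0_1 f0_gauss f0_ker f0_factors]] := compact_kernel HS Hc mu_haar Hoo.
have balls (rho : R) := cosets_in_ball rho GS HS cG reps.
have [f [fF [n fn] f_ker f_factors]] := discrete_extension GS erefl Hc balls
  f0F f0_1 f0_gauss f0_ker (f0_factors G (@subIsetl _ _ _)).
have fG : tau_ker q f = G by apply/seteqP; split=> z /f_ker.
exists f; split=> // g gF gG; apply: (kernel_unique fF fn) => //; rewrite fG//.
Qed.

End TauSeries.

Theorem theorem5p5 (p e q : nat) (hp : prime p) (he : (0 < e)%N)
    (hq : q = (p ^ e)%N)
    (Fq : finFieldType) (hFq : #|Fq| = q)
    (R : realType) (C : closedFieldType) (a : nonarch_abs R C)
    (hC : abs_complete a)
    (iota : {rmorphism Fq -> valued a})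
    (r : R) (hr : 0 < r)
    (G : set (valued a)) (hG : calG iota r G) :
  exists f : tau_series a,
    [/\ calF q f,
        tau_ker q f = G
      & forall g : tau_series a, calF q g -> tau_ker q g = G ->
          exists (eps : valued a) (n : int),
            eps != 0 /\ g = tau_comp q (tau_mono eps n) f].
Proof.
(* The characteristic is read off from the embedded field of [p ^ e] elements. *)
have pchar_p : p \in [pchar (valued a)].
  by apply: (rmorph_pchar iota); apply: (@card_finPcharP _ _ e); rewrite ?hFq.
apply: (calG_kernel hC _ _ hFq (ltW hr) hG).
  by rewrite hq (leq_trans (prime_gt1 hp))// -{1}(expn1 p) leq_exp2l ?prime_gt1.
by rewrite hq pnatX pnatE// pchar_p.
Qed.
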